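(* Let $G$ be a compact Lie group, $n\ge 1$, and let $C$ be a conjugacy class in $G$ such that $p^2\in Z(G)$ for every $p\in C$ and $C=C^{-1}=\{g\in G: g^{-1}\in C\}$. Let $\mathcal C=(C,\dots,C)$ ($2n$ copies), let $\mathscr M\subset C^{2n}$ be the $\mathcal B_{2n}$-invariant symplectic manifold with form $\omega_{\mathcal C}$ described in the context (with $m=2n$), and let $$\Lambda=\{(p_1,\dots,p_{2n})\in C^{2n} : p_{2n-i+1}=p_i^{-1},\ i=1,\dots,n\}.$$ Then for every $\tau\in\mathcal B_{2n}$, $\tau(\Lambda)$ is a Lagrangian submanifold of $\mathscr M$.
   Context: Let $\mathfrak g$ be the Lie algebra of $G$, equipped with an $\mathrm{Ad}$-invariant positive definite inner product $\bullet$; $Z(G)$ is the center of $G$. Let $\omega$ (resp. $\bar\omega$) be the left-invariant (resp. right-invariant) $\mathfrak g$-valued Maurer--Cartan $1$-form on $G$: $\omega(g\cdot X)=X$, $\bar\omega(X\cdot g)=X$ for $X\in\mathfrak g$, $g\in G$. On $G\times G$ define the $2$-form $\Omega=\frac12\,\omega_1\bullet\bar\omega_2$, i.e. $\Omega(U,V)=\frac12\big(\omega_1(U)\bullet\bar\omega_2(V)-\bar\omega_2(U)\bullet\omega_1(V)\big)$, where the index $j$ denotes pull-back by the projection to the $j$-th factor. Let $r:C^m\to G$, $r(g_1,\dots,g_m)=g_1\cdots g_m$, and $K=r^{-1}(e)$. For $1\le j\le m-1$ let $E_j(g_1,\dots,g_m)=(g_1\cdots g_j,\,g_{j+1})\in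 G\times G$ and put $\omega_c=-\sum_{j=1}^{m-1}E_j^*\Omega$, a $2$-form on $C^m$. Let $\lambda$ be the left-invariant $3$-form on $G$ with $\lambda_e(x,y,z)=\frac12[x,y]\bullet z$, and $\beta=h(\exp^*\lambda)$, where $h:\Omega^*(\mathfrak g)\to\Omega^{*-1}(\mathfrak g)$ is the standard homotopy operator given by integration along linear paths from the origin, $(h\alpha)_x(v_1,\dots,v_{p-1})=\int_0^1t^{p-1}\alpha_{tx}(x,v_1,\dots,v_{p-1})\,dt$. Let $\widetilde{\mathscr O}\subset\mathfrak g$ be an open $\mathrm{Ad}$-invariant subset, star-shaped with respect to $0\in\widetilde{\mathscr O}$, on which $\exp$ is a diffeomorphism onto $\exp(\widetilde{\mathscr O})$; let $\mathscr H=r^{-1}(\exp(\widetilde{\mathscr O}))$ and $\tilde r=\exp^{-1}\circ r:\mathscr H\to\widetilde{\mathscr O}$. On $C$ let $\tau_C$ be the $2$-form $\tau_C(Xp-pX,\,Yp-pY)=\frac12\big(X\bullet \mathrm{Ad}(p)Y-Y\bullet \mathrm{Ad}(p)X\big)$, $p\in C$, $X,Y\in\mathfrak g$. With $f_i$ the projection to the $i$-th factor, define on $\mathscr H$ the $2$-form $\omega_{\mathcal C}=\omega_c-\tilde r^*\beta+\sum_i f_i^*\tau_C$. It is a theorem of Guruprasad--Huebschmann--Jeffrey--Weinstein that there is a $G$-invariant open neighbourhood $\mathscr M$ of $K$ in $\mathscr H$ on which $\omega_{\mathcal C}$ is symplectic. The braid group $\mathcal B_m$ with elementary braids $\sigma_1,\dots,\sigma_{m-1}$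 acts from the left on $C^m$ by $\sigma_k(g_1,\dots,g_m)=(g_1,\dots,g_{k-1},\,g_kg_{k+1}g_k^{-1},\,g_k,\,g_{k+2},\dots,g_m)$. One has $r\circ\sigma=r$ for all $\sigma\in\mathcal B_m$. The neighbourhood $\mathscr M$ is chosen of the form $\mathscr M=r^{-1}(U)$, with $U$ an open conjugation-invariant neighbourhood of $e$ in $G$; hence $\mathscr M$ is $\mathcal B_m$-invariant. *)

(* Defs.v *)
From HB Require Import structures.
From mathcomp Require Import all_boot all_order all_algebra.
From mathcomp Require Import generic_quotient.
From mathcomp Require Import zify.
From mathcomp Require Import all_classical all_reals all_analysis.
Set Implicit Arguments.
Unset Strict Implicit.
Unset Printing Implicit Defensive.
Import Order.TTheory GRing.Theory Num.Theory.
Import numFieldNormedType.Exports.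
Local Open Scope classical_set_scope.
Local Open Scope ring_scope.

Section SmoothIn.
Context {R : realType} {V W : normedModType R}.

Fixpoint Ck_in (n : nat) (A : set V) (f : V -> W) : Prop :=
  if n is k.+1 then
    (forall x, A x -> differentiable f x) /\
    (forall v, Ck_in k A (fun x => 'D_v f x))
  else forall x, A x -> {for x, continuous f}.

(* Meant for [A] open and [V] finite dimensional. *)
Definition smooth_in (A : set V) (f : V -> W) := forall n, Ck_in n A f.

End SmoothIn.

Record chart (R : realType) (E : normedModType R) (M : topologicalType) :=
  Chart {
  chart_dom : set M;
  chart_map : M -> E;
  chart_inv : E -> M }.
Arguments chart {R} E M.

Definition is_chart (R : realType) (E : normedModType R) (M : topologicalType)
    (c : chart E M) :=
  [/\ open (chart_dom c),
      open (chart_map c @` chart_dom c),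
      (forall p, chart_dom c p -> chart_inv c (chart_map c p) = p),
      (forall p, chart_dom c p -> {for p, continuous (chart_map c)}) &
      (forall x, (chart_map c @` chart_dom c) x ->
                 {for x, continuous (chart_inv c)})].

(* A preferred chart is attached to each point [p]. The tangent space at [p] is
   then the model space [E] itself, a vector of [E] standing for the tangent
   vector that has these coordinates in the chart [chart_at p]. *)
HB.mixin Record hasCharts (R : realType) (E : normedModType R) M
    of Topological M := {
  chart_at : M -> chart E M }.

#[short(type="chartedType")]
HB.structure Definition Charted (R : realType) (E : normedModType R) :=
  { M of hasCharts R E M & Topological M }.

Section TangentMap.
Context {R : realType} {E F : normedModType R}.
Context {M : chartedType E} {N : chartedType F}.

Definition read_in_charts (f : M -> N) (p : M) : E -> F :=
  chart_map (chart_at (f p)) \o f \o chart_inv (chart_at p).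

(* the tangent map T_p M -> T_(f p) N *)
Definition tmap (f : M -> N) (p : M) : E -> F :=
  'd (read_in_charts f p) (chart_map (chart_at p) p).

Definition smooth_on (A : set M) (f : M -> N) := forall p, A p ->
  {for p, continuous f} /\
  exists W : set E, [/\ open W, W (chart_map (chart_at p) p) &
                        smooth_in W (read_in_charts f p)].

End TangentMap.

Definition diffeo_on (R : realType) (E F : normedModType R)
    (M : chartedType E) (N : chartedType F) (A : set M) (f : M -> N) :=
  [/\ smooth_on A f, open (f @` A) &
      exists g : N -> M, smooth_on (f @` A) g /\ {in A, cancel f g}].

HB.mixin Record Charted_isManifold (R : realType) (E : normedModType R) M
    of Charted R E M := {
  manifold_hausdorff : hausdorff_space M;
  manifold_second_countable : @second_countable M;
  chart_atP : forall p : M, is_chart (chart_at p : chart E M);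
  mem_chart_at : forall p : M, chart_dom (chart_at p : chart E M) p;
  chart_at_compat : forall p q : M,
    let cp : chart E M := chart_at p in
    let cq : chart E M := chart_at q in
    smooth_in (chart_map cp @` (chart_dom cp `&` chart_dom cq))
              (chart_map cq \o chart_inv cp) }.

#[short(type="manifoldType")]
HB.structure Definition Manifold (R : realType) (E : normedModType R) :=
  { M of Charted_isManifold R E M & Charted R E M }.

Definition id_chart (R : realType) (E : normedModType R) : chart E E :=
  Chart setT id id.

HB.instance Definition _ (R : realType) (m n : nat) :=
  hasCharts.Build R 'M[R]_(m, n) 'M[R]_(m, n) (fun=> id_chart 'M[R]_(m, n)).

HB.instance Definition _ (R : realType) :=
  hasCharts.Build R R^o R^o (fun=> id_chart R^o).

Definition prod_chart (R : realType) (E F : normedModType R)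
    (M N : topologicalType) (c : chart E M) (c' : chart F N) :
    chart (E * F)%type (M * N)%type :=
  Chart (chart_dom c `*` chart_dom c')
        (fun p => (chart_map c p.1, chart_map c' p.2))
        (fun x => (chart_inv c x.1, chart_inv c' x.2)).

HB.instance Definition _ (R : realType) (E F : normedModType R)
    (M : chartedType E) (N : chartedType F) :=
  hasCharts.Build R (E * F)%type (M * N)%type
    (fun p => prod_chart (chart_at p.1) (chart_at p.2)).

Definition power (m : nat) (M : Type) : Type := 'I_m -> M.

HB.instance Definition _ (m : nat) (M : topologicalType) :=
  Topological.copy (power m M) (prod_topology (fun _ : 'I_m => M)).

(* The rows of a tangent vector [u : 'M[R]_(m, d)] of [power m M] at [p] are its
   components in the tangent spaces of the factors at the [p i]. *)
Definition power_chart (R : realType) (d m : nat) (M : topologicalType)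
    (c : 'I_m -> chart 'rV[R]_d M) : chart 'M[R]_(m, d) (power m M) :=
  Chart [set p : power m M | forall i, chart_dom (c i) (p i)]
        (fun p => \matrix_i chart_map (c i) (p i))
        (fun x => (fun i => chart_inv (c i) (row i x)) : power m M).

HB.instance Definition _ (R : realType) (d m : nat)
    (M : chartedType 'rV[R]_d) :=
  hasCharts.Build R 'M[R]_(m, d) (power m M)
    (fun p => power_chart (fun i => chart_at (p i))).

Section Forms.
Context {R : realType} {E : normedModType R} {M : chartedType E}.

Definition pullback2 (F : normedModType R) (N : chartedType F) (f : N -> M)
    (a : M -> E -> E -> R) : N -> F -> F -> R :=
  fun p u v => a (f p) (tmap f p u) (tmap f p v).

Definition pullback3 (F : normedModType R) (N : chartedType F) (f : N -> M)
    (a : M -> E -> E -> E -> R) : N -> F -> F -> F -> R :=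
  fun p u v w => a (f p) (tmap f p u) (tmap f p v) (tmap f p w).

(* Smooth injective immersion of the open set [W] of R^k, with values in [S],
   that is a homeomorphism onto a relatively open subset of [S]. *)
Definition local_param (k : nat) (S : set M) (W : set 'rV[R]_k)
    (f : 'rV[R]_k -> M) :=
  [/\ open W, smooth_on W f, {in W &, injective f},
      (forall x, W x -> injective (tmap f x)) &
      (forall W', open W' -> W' `<=` W ->
         exists2 O : set M, open O & f @` W' = S `&` O)].

Definition submanifold (k : nat) (S : set M) := forall p, S p ->
  exists W (f : 'rV[R]_k -> M) x, [/\ local_param S W f, W x & f x = p].

Definition tangent (S : set M) (p : M) : set E :=
  [set v | exists k W (f : 'rV[R]_k -> M) x u,
     [/\ local_param S W f, W x, f x = p & v = tmap f x u]].

(* Only the values of [a] on the tangent spaces of the submanifold [S] matter in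
   the following notions. *)
Definition is_form2 (S : set M) (a : M -> E -> E -> R) :=
  forall k W (f : 'rV[R]_k -> M), local_param S W f ->
  [/\ (forall x, W x -> forall u, pullback2 f a x u u = 0),
      (forall x, W x -> forall c u v w, pullback2 f a x (c *: u + v) w =
         c * pullback2 f a x u w + pullback2 f a x v w) &
      (forall u v, smooth_in W (fun x => pullback2 f a x u v : R^o))].

(* In a parametrization, the exterior derivative is evaluated on the constant
   vector fields [u], [v], [w]. *)
Definition closed_form2 (S : set M) (a : M -> E -> E -> R) :=
  forall k W (f : 'rV[R]_k -> M), local_param S W f ->
  forall x, W x -> forall u v w,
    'D_u (fun y => pullback2 f a y v w : R^o) x
    - 'D_v (fun y => pullback2 f a y u w : R^o) x
    + 'D_w (fun y => pullback2 f a y u v : R^o) x = 0.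

Definition nondegenerate2 (S : set M) (a : M -> E -> E -> R) :=
  forall p, S p -> forall v, tangent S p v ->
  (forall w, tangent S p w -> a p v w = 0) -> v = 0.

Definition symplectic (S : set M) (a : M -> E -> E -> R) :=
  [/\ is_form2 S a, closed_form2 S a & nondegenerate2 S a].

(* As [S] is an embedded submanifold of the ambient manifold, the submanifolds
   of [S] are those of the ambient manifold that are contained in [S]. *)
Definition lagrangian_submanifold (S : set M) (a : M -> E -> E -> R)
    (L : set M) :=
  [/\ L `<=` S,
      (exists k, submanifold k L /\ submanifold (2 * k)%N S) &
      (forall p, L p -> forall u v, tangent L p u -> tangent L p v ->
         a p u v = 0)].

End Forms.

HB.mixin Record isLieGroup (R : realType) (d : nat) G
    of Manifold R 'rV[R]_d G & Group G := {
  mulg_smooth : smooth_on [set: (G * G)%type] (fun p : G * G => (p.1 * p.2)%g);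
  invg_smooth : smooth_on [set: G] (fun x : G => (x^-1)%g) }.

#[short(type="lieGroupType")]
HB.structure Definition LieGroup (R : realType) (d : nat) :=
  { G of isLieGroup R d G & Manifold R 'rV[R]_d G & Group G }.

Definition conjugacy_class (G : groupType) (C : set G) :=
  exists p : G, C = [set (g * p * g^-1)%g | g in [set: G]].

Definition centerg {G : groupType} : set G :=
  [set z | forall g : G, (g * z = z * g)%g].

Definition rprod (m : nat) (G : groupType) (p : power m G) : G :=
  (\prod_(i < m) p i)%g.

Section LieTheory.
Context {R : realType} {d : nat} {G : lieGroupType R d}.
(* the Lie algebra, that is, the tangent space of [G] at [1] *)
Local Notation g := 'rV[R]_d.
Implicit Types (p : G) (u v w X Y : g).

Definition lmulv p X : g := tmap (fun x : G => (p * x)%g) 1%g X.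
Definition rmulv X p : g := tmap (fun x : G => (x * p)%g) 1%g X.

Definition mc_left p u : g := tmap (fun x : G => (p^-1 * x)%g) p u.
Definition mc_right p u : g := tmap (fun x : G => (x * p^-1)%g) p u.

Definition Ad p X : g := tmap (fun x : G => (p * x * p^-1)%g) 1%g X.

(* [[X, Y] = ad X Y], where [ad] is the differential of [Ad] at [1] *)
Definition bracket X Y : g := tmap (fun x : G => Ad x Y) 1%g X.

Definition one_param_subgroup X (c : R^o -> G) :=
  [/\ smooth_on setT c, (forall s t, c (s + t) = (c s * c t)%g) &
      tmap c 0 1 = X].

Definition exp X : G := xget (fun=> 1%g) (one_param_subgroup X) 1.

Variable ip : g -> g -> R.

Definition Ad_invariant_inner_product :=
  [/\ (forall c X Y Z, ip (c *: X + Y) Z = c * ip X Z + ip Y Z),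
      (forall X Y, ip X Y = ip Y X),
      (forall X, X != 0 -> 0 < ip X X) &
      (forall p X Y, ip (Ad p X) (Ad p Y) = ip X Y)].

Definition Omega (p : G * G) (u v : g * g) : R :=
  2^-1 * (ip (mc_left p.1 u.1) (mc_right p.2 v.2)
          - ip (mc_right p.2 u.2) (mc_left p.1 v.1)).

Definition lambda p u v w : R :=
  2^-1 * ip (bracket (mc_left p u) (mc_left p v)) (mc_left p w).

Definition homotopy3 (a : g -> g -> g -> g -> R) (x v w : g) : R :=
  \int[lebesgue_measure]_(t in `[0, 1]) (t ^+ 2 * a (t *: x) x v w).

Definition beta : g -> g -> g -> R := homotopy3 (pullback3 exp lambda).

(* The tangent space of a conjugacy class at [p] consists of the vectors
   [rmulv X p - lmulv p X], and the value does not depend on the choice of [X]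
   and [Y]. *)
Definition tauC p u v : R :=
  let X := xget 0 [set X | u = rmulv X p - lmulv p X] in
  let Y := xget 0 [set Y | v = rmulv Y p - lmulv p Y] in
  2^-1 * (ip X (Ad p Y) - ip Y (Ad p X)).

Variable m : nat.

(* For [0 < j] this is E_j, since indices start from 0: the pair is formed by
   the product of the first [j] entries and the entry that follows them. *)
Definition Emap (j : 'I_m) (p : power m G) : G * G :=
  ((\prod_(i < m | (i < j)%N) p i)%g, p j).

Definition omega_c (p : power m G) (u v : 'M[R]_(m, d)) : R :=
  - \sum_(j < m | (0 < j)%N) pullback2 (Emap j) Omega p u v.

Variable O : set g.

Definition exp_domain :=
  [/\ open O, (forall p X, O X -> O (Ad p X)), O 0,
      (forall X t, O X -> 0 <= t <= 1 -> O (t *: X)) & diffeo_on O exp].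

Definition rtilde (p : power m G) : g := 'pinv_(fun=> 0) O exp (rprod p).

Definition omegaC (p : power m G) (u v : 'M[R]_(m, d)) : R :=
  omega_c p u v - pullback2 rtilde beta p u v
  + \sum_(i < m) tauC (p i) (row i u) (row i v).

End LieTheory.

Definition cpower (m : nat) (G : Type) (C : set G) : set (power m G) :=
  [set p | forall i, C (p i)].

(* the part of C^m lying in r^{-1}(U) *)
Definition calM (m : nat) {G : groupType} (C U : set G) : set (power m G) :=
  [set p | cpower C p /\ U (rprod p)].
Arguments calM m {G} C U.

(* The letter [(k, b)] is the elementary braid exchanging the positions [k] and
   [k + 1], counted from 0, or its inverse if [b] holds. *)
Definition braid_word (m : nat) := seq ('I_m.-1 * bool).

Inductive braid_eq (m : nat) : braid_word m -> braid_word m -> Prop :=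
| BraidRefl w : braid_eq w w
| BraidSym v w : braid_eq v w -> braid_eq w v
| BraidTrans u v w : braid_eq u v -> braid_eq v w -> braid_eq u w
| BraidCat u u' v v' :
    braid_eq u u' -> braid_eq v v' -> braid_eq (u ++ v) (u' ++ v')
| BraidInv k b : braid_eq [:: (k, b); (k, ~~ b)] [::]
| BraidFar (k l : 'I_m.-1) : (k.+1 < l)%N ->
    braid_eq [:: (k, false); (l, false)] [:: (l, false); (k, false)]
| BraidNear (k l : 'I_m.-1) : l = k.+1 :> nat ->
    braid_eq [:: (k, false); (l, false); (k, false)]
             [:: (l, false); (k, false); (l, false)].

Definition braid_eqb (m : nat) (v w : braid_word m) : bool :=
  `[< braid_eq v w >].

Lemma braid_eqb_equiv (m : nat) : equiv_class_of (@braid_eqb m).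
Proof.
split=> [w|v w|v u w].
- by apply/asboolP; exact: BraidRefl.
- by apply/asboolP/asboolP; exact: BraidSym.
- by move=> /asboolP uv /asboolP vw; apply/asboolP; exact: BraidTrans uv vw.
Qed.

Canonical braid_equiv (m : nat) := EquivRelPack (@braid_eqb_equiv m).

Definition braid (m : nat) := {eq_quot @braid_equiv m}%qT.
HB.instance Definition _ (m : nat) := Choice.on (braid m).
HB.instance Definition _ (m : nat) := EqQuotient.on (braid m).

Section BraidGroup.
Variable m : nat.
Implicit Types (v w : braid_word m) (s t : braid m).

Definition braid_of (w : braid_word m) : braid m := \pi_(braid m)%qT w.

Lemma braid_ofP v w : braid_of v = braid_of w <-> braid_eq v w.
Proof.
by split=> [/eqmodP/asboolP //|vw]; apply/eqmodP/asboolP.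
Qed.

Lemma repr_braid_of w : braid_eq (repr (braid_of w)) w.
Proof. by apply/braid_ofP; rewrite /braid_of reprK. Qed.

Lemma braid_of_repr s : braid_of (repr s) = s.
Proof. exact: reprK. Qed.

Definition word_inv w : braid_word m := rev [seq (a.1, ~~ a.2) | a <- w].

Lemma word_invK w : word_inv (word_inv w) = w.
Proof.
rewrite /word_inv map_rev revK -map_comp map_id_in // => -[k b] _ /=.
by rewrite negbK.
Qed.

Lemma word_mulV w : braid_eq (w ++ word_inv w) [::].
Proof.
elim: w => [|[k b] w IH]; first exact: BraidRefl.
rewrite /word_inv map_cons rev_cons -/(word_inv w) -cats1 /=.
rewrite -[(k, b) :: _]/([:: (k, b)] ++ (w ++ (word_inv w ++ [:: (k, ~~ b)]))).
rewrite catA; apply: BraidTrans (BraidInv k b).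
rewrite -[[:: (k, b); (k, ~~ b)]]/([:: (k, b)] ++ ([::] ++ [:: (k, ~~ b)])).
rewrite -catA; apply: BraidCat; first exact: BraidRefl.
by rewrite catA; apply: BraidCat => //; exact: BraidRefl.
Qed.

Lemma word_mulVl w : braid_eq (word_inv w ++ w) [::].
Proof. by rewrite -{2}(word_invK w); exact: word_mulV. Qed.

Definition braid_mul s t := braid_of (repr s ++ repr t).
Definition braid_one : braid m := braid_of [::].
Definition braid_inv s := braid_of (word_inv (repr s)).

Lemma braid_mulE v w : braid_mul (braid_of v) (braid_of w) = braid_of (v ++ w).
Proof. by apply/braid_ofP; apply: BraidCat; exact: repr_braid_of. Qed.

Fact braid_mulA : associative braid_mul.
Proof.
move=> s t u; rewrite -(braid_of_repr s) -(braid_of_repr t) -(braid_of_repr u).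
by rewrite !braid_mulE catA.
Qed.

Fact braid_mul1 : left_id braid_one braid_mul.
Proof. by move=> s; rewrite -(braid_of_repr s) braid_mulE. Qed.

Fact braid_mulr1 : right_id braid_one braid_mul.
Proof. by move=> s; rewrite -(braid_of_repr s) braid_mulE cats0. Qed.

Fact braid_mulV : left_inverse braid_one braid_inv braid_mul.
Proof.
move=> s; rewrite -{2}(braid_of_repr s) braid_mulE.
by apply/braid_ofP; exact: word_mulVl.
Qed.

Fact braid_mulrV : right_inverse braid_one braid_inv braid_mul.
Proof.
move=> s; rewrite -{1}(braid_of_repr s) braid_mulE.
by apply/braid_ofP; exact: word_mulV.
Qed.

HB.instance Definition _ := isGroup.Build (braid m)
  braid_mulA braid_mul1 braid_mulr1 braid_mulV braid_mulrV.

End BraidGroup.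

Section BraidAction.
Context {m : nat} {G : groupType}.
Implicit Types (k l : 'I_m.-1) (p : power m G).

Lemma ord_hi_subproof k : (k.+1 < m)%N.
Proof. by rewrite -ltn_predRL. Qed.

Definition ord_lo k : 'I_m := widen_ord (leq_pred m) k.
Definition ord_hi k : 'I_m := Ordinal (ord_hi_subproof k).

Definition elem_braid k p : power m G := fun i =>
  if i == ord_lo k then (p (ord_lo k) * p (ord_hi k) * (p (ord_lo k))^-1)%g
  else if i == ord_hi k then p (ord_lo k) else p i.

Definition elem_braid_inv k p : power m G := fun i =>
  if i == ord_lo k then p (ord_hi k)
  else if i == ord_hi k then
    ((p (ord_hi k))^-1 * p (ord_lo k) * p (ord_hi k))%g
  else p i.

Definition letter_act (a : 'I_m.-1 * bool) p : power m G :=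
  if a.2 then elem_braid_inv a.1 p else elem_braid a.1 p.

Definition word_act (w : braid_word m) p : power m G := foldr letter_act p w.

Definition braid_act (s : braid m) p : power m G := word_act (repr s) p.

Lemma lo_neq_hi k : (ord_lo k == ord_hi k) = false.
Proof. by apply/eqP => /(congr1 val)/= /eqP; rewrite ltn_eqF. Qed.

Lemma hi_neq_lo k : (ord_hi k == ord_lo k) = false.
Proof. by rewrite eq_sym lo_neq_hi. Qed.

Lemma elem_braidK k : cancel (elem_braid k) (elem_braid_inv k).
Proof.
move=> p; apply/funext => i; rewrite /elem_braid_inv /elem_braid !eqxx.
rewrite ?hi_neq_lo; case: eqP => [->//|_]; case: eqP => [->|//].
by rewrite !mulgA mulVg mul1g -mulgA mulVg mulg1.
Qed.

Lemma elem_braid_invK k : cancel (elem_braid_inv k) (elem_braid k).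
Proof.
move=> p; apply/funext => i; rewrite /elem_braid_inv /elem_braid !eqxx.
rewrite ?hi_neq_lo; case: eqP => [->|_]; last by case: eqP => [->|//].
by rewrite !mulgA mulgV mul1g -mulgA mulgV mulg1.
Qed.

Lemma word_act_eq v w : braid_eq v w -> word_act v = word_act w.
Proof.
elim=> {v w} [//|v w _ ->//|u v w _ -> _ ->//
             |u u' v v' _ IHu _ IHv|k b|k l kl|k l kl]; apply/funext => p.
- by rewrite /word_act !foldr_cat -!/(word_act _ _) IHu IHv.
- by rewrite /word_act/letter_act/=; case: b;
    rewrite /= ?elem_braidK ?elem_braid_invK.
- have E (x y : 'I_m) : nat_of_ord x != y -> (x == y) = false.
    by move=> /negbTE; rewrite -val_eqE.
  have lolo : (ord_lo k == ord_lo l) = false by apply: E => /=; lia.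
  have lohi : (ord_lo k == ord_hi l) = false by apply: E => /=; lia.
  have hilo : (ord_hi k == ord_lo l) = false by apply: E => /=; lia.
  have hihi : (ord_hi k == ord_hi l) = false by apply: E => /=; lia.
  apply/funext => i; rewrite /word_act /letter_act /= /elem_braid.
  rewrite lolo lohi hilo hihi ![ord_lo l == _]eq_sym ![ord_hi l == _]eq_sym.
  rewrite lolo lohi hilo hihi.
  case: (eqVneq i (ord_lo k)) => [->|_]; first by rewrite lolo lohi.
  by case: (eqVneq i (ord_hi k)) => [->|_]; first by rewrite hilo hihi.
- have hl : ord_lo l = ord_hi k by apply: val_inj.
  have E (x y : 'I_m) : nat_of_ord x != y -> (x == y) = false.
    by move=> /negbTE; rewrite -val_eqE.
  have lohi : (ord_lo k == ord_hi l) = false by apply: E => /=; lia.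
  have hilo : (ord_hi l == ord_lo k) = false by rewrite eq_sym.
  have hihi : (ord_hi k == ord_hi l) = false by apply: E => /=; lia.
  have hihi' : (ord_hi l == ord_hi k) = false by rewrite eq_sym.
  apply/funext => i; rewrite /word_act /letter_act /= /elem_braid hl.
  rewrite !(eqxx, lohi, hilo, hihi, hihi', lo_neq_hi, hi_neq_lo).
  case: (eqVneq i (ord_lo k)) => [->|_].
    rewrite ?(eqxx, lohi, hilo, hihi, hihi', lo_neq_hi, hi_neq_lo).
    by rewrite !(invgM, invgK, mulgA) !mulgVK.
  case: (eqVneq i (ord_hi k)) => [//|_].
  by case: (eqVneq i (ord_hi l)).
Qed.

Lemma braid_act_of w p : braid_act (braid_of w) p = word_act w p.
Proof. by rewrite /braid_act (word_act_eq (repr_braid_of w)). Qed.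

Lemma braid_act1 p : braid_act 1%g p = p.
Proof. exact: braid_act_of. Qed.

Lemma braid_actM s t p : braid_act (s * t)%g p = braid_act s (braid_act t p).
Proof.
by rewrite [LHS]braid_act_of /word_act foldr_cat.
Qed.

End BraidAction.

Definition Lambda (n : nat) {G : groupType} (C : set G) :
    set (power (2 * n)%N G) :=
  [set p | cpower C p /\
     forall i : 'I_(2 * n)%N, (i < n)%N -> p (rev_ord i) = (p i)^-1%g].
Arguments Lambda n {G} C.

(* Main.v *)
(* Since p^2 is central for p in C, each Ad p is an involution, hence a symmetric
   endomorphism, so tau_C vanishes. On tau(Lambda) the product map r is constant
   equal to 1, and beta vanishes at 0. Only omega_c is left: with
   theta_i = Ad(g_1 ... g_(i-1)) (dg_i g_i^-1) it is -1/2 sum_(i < j) theta_i ^ theta_j.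
   An elementary braid fixes all theta_i except two adjacent ones, whose sum and
   whose wedge product it preserves on vectors tangent to C^m; and on Lambda the
   sequence theta is anti-palindromic, so that the sum of the wedge products
   vanishes. Locally at p, C consists of the exp(Y) p with Ad(p) Y = -Y: these
   elements are the conjugates exp(Y/2) p exp(-Y/2), and conversely
   (exp(Y) p)^2 = p^2 says exp(Ad(p) Y) = exp(-Y). This linear model gives the
   charts of C^2n and of its submanifold Lambda = C^n, of half the dimension. *)

(* Embedded parametrizations, on which [tangent] is built, are awkward to push through a braid.
   Isotropy is therefore proved for the larger class [velocity], which every smooth map preserves,
   and a braid word is then peeled off letter by letter. Differentials of group-valued maps are
   translated to the unit on the right. The product rule becomes a cocycle rule, under which the
   partial product g_1 ... g_j has velocity theta_1 + ... + theta_j; this is what turns omega_c into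
   a sum of wedge products. [exp] is a choice with default value 1, so its properties are drawn from
   [exp_domain]: injectivity on [O] forces one-parameter subgroups to exist there, and they are
   unique because a curve of zero velocity is constant. [O] is not assumed symmetric, so the charts
   of C have to ask for both Y and -Y in [O]. Submanifolds are produced from parametrizations whose
   inverse extends smoothly to an open set of the ambient manifold: such an extension yields the
   immersion and the embedding property together and survives products and braids. *)
Require Import Defs.
From HB Require Import structures.
From mathcomp Require Import all_boot all_order all_algebra.
From mathcomp Require Import all_classical all_reals all_analysis.
From mathcomp Require Import zify ring lra.
Set Implicit Arguments.
Unset Strict Implicit.
Unset Printing Implicit Defensive.
Import Order.TTheory GRing.Theory Num.Theory.
Import numFieldNormedType.Exports.
Local Open Scope classical_set_scope.
Local Open Scope ring_scope.

(** * Maps of class C^k between normed spaces *)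

Section Calculus.
Context {R : realType}.
Implicit Types V W Z : normedModType R.

Lemma near_eq_is_diff V W (f g df : V -> W) x :
  (\near x, f x = g x) -> is_diff x f df -> is_diff x g df.
Proof.
move=> fg [fx <-]; have fgx := nbhs_singleton fg.
have [dc dE] := (diff_locallyP _ _).1 fx.
have dE' : g \o shift x = cst (g x) + 'd f x +o_ 0 id.
  apply/eqaddoP => _/posnumP[e].
  move: dE => /eqaddoP/(_ e%:num ltac:(by [])) dE.
  have fg0 : \forall h \near 0, f (h + x) = g (h + x).
    by move: fg; rewrite (near_shift 0) /= subr0.
  near=> h; have fgh : f (h + x) = g (h + x) by near: h.
  suff -> : (g \o shift x - (cst (g x) + 'd f x)) h =
            (f \o shift x - (cst (f x) + 'd f x)) h by near: h.
  rewrite -[LHS]/(g (h + x) - (g x + 'd f x h)).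
  by rewrite -[RHS]/(f (h + x) - (f x + 'd f x h)) fgh fgx.
have gd : 'd g x = 'd f x :> (V -> W) by exact: diff_unique.
split; last exact: gd.
by apply/diff_locallyP; rewrite gd; split; [exact: dc | exact: dE'].
Unshelve. all: by end_near. Qed.

Lemma deriveE_is_diff V W (f df : V -> W) x v :
  is_diff x f df -> 'D_v f x = df v.
Proof. by move=> [fx <-]; rewrite deriveE. Qed.

(** Finite dimension in the form that the chain rule uses: a finite spanning family, not necessarily
    independent, with continuous linear coordinates. *)
Definition finite_coords W := exists (I : finType) (e : I -> W)
  (c : I -> {linear W -> R^o}),
  (forall i, continuous (c i)) /\ forall w, w = \sum_i c i w *: e i.

Lemma finite_coords_regular : finite_coords R^o.
Proof.
exists unit, (fun=> 1), (fun=> idfun); split=> [_ x|w]; first exact: cvg_id.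
by rewrite (big_pred1 tt) => [|[]//]; rewrite /GRing.scale /= mulr1.
Qed.

Lemma finite_coords_mx m n : finite_coords 'M[R]_(m, n).
Proof.
pose c (k : 'I_m * 'I_n) (A : 'M[R]_(m, n)) : R^o := A k.1 k.2.
have lin k : linear (c k) by move=> a A B; rewrite /c !mxE.
pose L k : {linear 'M[R]_(m, n) -> R^o} :=
  HB.pack (c k) (GRing.isLinear.Build _ _ _ _ _ (lin k)).
exists ('I_m * 'I_n)%type, (fun k => delta_mx k.1 k.2), L; split.
  by move=> k; exact: coord_continuous.
by move=> A; rewrite {1}[A]matrix_sum_delta pair_bigA.
Qed.

Lemma finite_coords_pair V W :
  finite_coords V -> finite_coords W -> finite_coords (V * W)%type.
Proof.
move=> [I [e [c [cc ce]]]] [J [e' [c' [cc' ce']]]].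
exists (I + J)%type,
  (fun k => match k with inl i => (e i, 0) | inr j => (0, e' j) end),
  (fun k => match k return {linear (V * W)%type -> R^o} with
     inl i => c i \o fst | inr j => c' j \o snd end).
split=> [[i|j] x|[v w]] /=.
- by apply: (@continuous_comp _ _ _ fst (c i)); [exact: cvg_fst | exact: cc].
- by apply: (@continuous_comp _ _ _ snd (c' j)); [exact: cvg_snd | exact: cc'].
rewrite big_sumType /=.
under eq_bigr do rewrite -[_ *: _]/(_, _) scaler0.
under [X in _ + X]eq_bigr do rewrite -[_ *: _]/(_, _) scaler0.
have E (K : finType) (F : K -> V) (F' : K -> W) :
    \sum_k (F k, F' k) = (\sum_k F k, \sum_k F' k).
  by rewrite [LHS]surjective_pairing (raddf_sum fst) (raddf_sum snd).
by rewrite !E !big1_eq -[_ + _]/(_, _) addr0 add0r -ce -ce'.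
Qed.

Lemma linear_finite_coords_continuous V W (f : {linear V -> W}) :
  finite_coords V -> continuous f.
Proof.
move=> [I [e [c [cc ce]]]].
have -> : (f : V -> W) = fun v => \sum_i c i v *: f (e i).
  by apply/funext => v; rewrite {1}[v]ce linear_sum; apply: eq_bigr => i _;
    rewrite linearZ.
apply: continuous_big => [|i _]; first exact: add_continuous.
by move=> v; apply: cvgZr_tmp; exact: cc.
Qed.

Section Ck.
Variables (V W : normedModType R).
Implicit Types (A B : set V) (f g : V -> W).

Lemma Ck_in_sub n A B f : B `<=` A -> Ck_in n A f -> Ck_in n B f.
Proof.
move=> BA; elim: n f => [|n IH] f /=; first by move=> fA x /BA/fA.
by move=> [fd fA]; split=> [x /BA/fd //|v]; exact/IH/fA.
Qed.

Lemma open_near_eq A f g x : open A -> {in A, f =1 g} -> A x ->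
  \near x, f x = g x.
Proof.
move=> Ao fg Ax; near=> y; apply: fg; rewrite inE.
by near: y; exact: open_nbhs_nbhs.
Unshelve. all: by end_near. Qed.

Lemma Ck_in_eq n A f g : open A -> {in A, f =1 g} ->
  Ck_in n A f -> Ck_in n A g.
Proof.
move=> Ao; elim: n f g => [|n IH] f g fg /=.
  move=> fA x Ax; have fgx := open_near_eq Ao fg Ax.
  rewrite /prop_for /continuous_at -(nbhs_singleton fgx).
  exact: cvg_trans (near_eq_cvg fgx) (fA x Ax).
move=> [fd fA]; split=> [x Ax|v].
  have fgx := open_near_eq Ao fg Ax.
  have gx := near_eq_is_diff fgx (differentiableP (fd x Ax)).
  exact: ex_diff.
apply: IH (fA v) => x; rewrite inE => Ax.
exact/near_eq_derive/(open_near_eq Ao fg Ax).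
Qed.

Lemma Ck_inS n A f : Ck_in n.+1 A f -> Ck_in n A f.
Proof.
elim: n f => [|n IH] f [fd fA].
  by move=> x /fd/differentiable_continuous.
by split=> // v; exact/IH/fA.
Qed.

Lemma Ck_in_cst n A (a : W) : Ck_in n A (cst a).
Proof.
elim: n a => [|n IH] a /=; first by move=> x _; exact: cvg_cst.
split=> // v; rewrite (_ : (fun x => _) = cst 0) //.
by apply/funext => x; rewrite derive_cst.
Qed.

Lemma Ck_in_linear n A (f : {linear V -> W}) : continuous f -> Ck_in n A f.
Proof.
case: n => [|n] fc /=; first by move=> x _; exact: fc.
split=> [x _|v]; first exact: linear_differentiable.
rewrite (_ : (fun x => _) = cst (f v)); first exact: Ck_in_cst.
by apply/funext => x; rewrite deriveE ?diff_lin//; exact: linear_differentiable.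
Qed.

Lemma Ck_inD n A f g : open A ->
  Ck_in n A f -> Ck_in n A g -> Ck_in n A (f \+ g).
Proof.
move=> Ao; elim: n f g => [|n IH] f g /=.
  by move=> fA gA x Ax; apply: cvgD; [exact: fA | exact: gA].
move=> [fd fA] [gd gA]; split=> [x Ax|v].
  by apply: differentiableD; [exact: fd | exact: gd].
apply: Ck_in_eq Ao _ (IH _ _ (fA v) (gA v)) => x; rewrite inE => Ax /=.
by rewrite deriveD //; apply: diff_derivable; [exact: fd | exact: gd].
Qed.

Lemma Ck_in_sum n A (I : Type) (r : seq I) (f : I -> V -> W) : open A ->
  (forall i, Ck_in n A (f i)) -> Ck_in n A (fun x => \sum_(i <- r) f i x).
Proof.
move=> Ao fA; elim: r => [|i r IH].
  rewrite (_ : (fun _ => _) = cst 0); first exact: Ck_in_cst.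
  by apply/funext => x; rewrite big_nil.
rewrite (_ : (fun _ => _) = f i \+ (fun x => \sum_(i <- r) f i x)).
  exact: Ck_inD.
by apply/funext => x; rewrite big_cons.
Qed.

End Ck.

Lemma scale_bilinear V :
  bilinear_for (GRing.Scale.Law.clone _ _ *:%R _)
    (GRing.Scale.Law.clone _ _ *:%R _) (fun (a : R^o) (v : V) => a *: v).
Proof.
split=> [v|a] k x y /=; first by rewrite scalerDl scalerA.
by rewrite scalerDr !scalerA mulrC.
Qed.

Lemma is_diff_scale V W (k : V -> R^o) (f : V -> W) (dk : V -> R^o)
    (df : V -> W) x :
  is_diff x k dk -> is_diff x f df ->
  is_diff x (fun y => k y *: f y) (fun y => k x *: df y + dk y *: f x).
Proof.
move=> kx fx.
pose b : {bilinear R^o -> W -> W} := HB.pack (fun (a : R^o) (v : W) => a *: v)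
  (bilinear_isBilinear.Build R R^o W W _ _ _ (@scale_bilinear W)).
have bc : continuous (fun p : R^o * W => b p.1 p.2) by exact: scale_continuous.
have bd : is_diff (k x, f x) (fun p : R^o * W => b p.1 p.2)
    (fun q => k x *: q.2 + q.1 *: f x).
  by apply: DiffDef; [exact: differentiable_bilin | rewrite diff_bilin].
have kf := is_diff_pair kx fx.
exact: (@is_diff_comp _ _ _ _ _ _ _ _ _ kf bd).
Qed.

Lemma Ck_inZ V W n (A : set V) (k : V -> R^o) (f : V -> W) : open A ->
  Ck_in n A k -> Ck_in n A f -> Ck_in n A (fun x => k x *: f x).
Proof.
move=> Ao; elim: n k f => [|n IH] k f.
  by move=> kA fA x Ax; apply: cvgZ; [exact: kA | exact: fA].
move=> /[dup] /Ck_inS kn [kd kA] /[dup] /Ck_inS fn [fd fA].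
have D x (Ax : A x) :=
  is_diff_scale (differentiableP (kd x Ax)) (differentiableP (fd x Ax)).
split=> [x Ax|v]; first by have Dx := D x Ax; exact: ex_diff.
apply: Ck_in_eq Ao _ (Ck_inD Ao (IH _ _ kn (fA v)) (IH _ _ (kA v) fn)) => x.
rewrite inE => Ax /=; rewrite (deriveE_is_diff _ (D x Ax)) !deriveE //.
- exact: kd.
- exact: fd.
Qed.

Lemma Ck_in_linear_comp V W Z n (A : set V) (L : {linear W -> Z}) (f : V -> W) :
  open A -> continuous L -> Ck_in n A f -> Ck_in n A (L \o f).
Proof.
move=> Ao Lc; elim: n f => [|n IH] f.
  by move=> fA x Ax; apply: continuous_comp; [exact: fA | exact: Lc].
move=> [fd fA].
have D x (Ax : A x) := @is_diff_comp _ _ _ _ _ _ _ _ _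
  (differentiableP (fd x Ax)) (differentiableP (linear_differentiable (f x) Lc)).
split=> [x Ax|v]; first by have Dx := D x Ax; exact: ex_diff.
apply: Ck_in_eq Ao _ (IH _ (fA v)) => x; rewrite inE => Ax /=.
by rewrite (deriveE_is_diff _ (D x Ax)) /= diff_lin ?deriveE //; exact: fd.
Qed.

Lemma Ck_in_comp V W Z n (A : set V) (B : set W) (f : V -> W) (g : W -> Z) :
  finite_coords W -> open A -> open B -> (forall x, A x -> B (f x)) ->
  Ck_in n A f -> Ck_in n B g -> Ck_in n A (g \o f).
Proof.
move=> [I [e [c [cc ce]]]] Ao Bo AB; elim: n g => [|n IH] g.
  by move=> fA gB x Ax; apply: continuous_comp; [exact: (fA _ Ax) | exact: (gB _ (AB _ Ax))].
move=> /[dup] /Ck_inS fn [fd fA] [gd gB].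
have D x (Ax : A x) := @is_diff_comp _ _ _ _ _ _ _ _ _
  (differentiableP (fd x Ax)) (differentiableP (gd _ (AB _ Ax))).
split=> [x Ax|v]; first by have Dx := D x Ax; exact: ex_diff.
(* The derivative of [g] along the moving vector ['D_v f x] is expanded along the fixed vectors
   [e i], so that the induction hypothesis applies to each ['D_(e i) g]. *)
have S : Ck_in n A (fun x => \sum_i c i ('D_v f x) *: 'D_(e i) g (f x)).
  apply: Ck_in_sum => // i; apply: Ck_inZ => //; last exact: (IH ('D_(e i) g) fn (gB (e i))).
  exact: (Ck_in_linear_comp Ao (cc i) (fA v)).
apply: Ck_in_eq Ao _ S => x; rewrite inE => Ax.
rewrite (deriveE_is_diff _ (D x Ax)) /= [in RHS](ce ('d f x v)) linear_sum.
apply: eq_bigr => i _.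
rewrite linearZ [in LHS](deriveE v (fd x Ax)); congr (_ *: _).
exact/deriveE/(gd _ (AB _ Ax)).
Qed.

End Calculus.

(** * Charts *)

Section Charts.
Context {R : realType}.

(** Products and powers of manifolds carry charts but no manifold structure here. Tangent maps and
    their chain rule rest on this property alone, which passes to products and powers; compatibility
    of different charts enters only in [smooth_at_chart_map]. *)
Definition good_charts (E : normedModType R) (M : chartedType E) :=
  forall p : M, is_chart (chart_at p : chart E M) /\
                chart_dom (chart_at p : chart E M) p.

(** [smooth_on A f] unfolds to [smooth_at f p] for all [p] in [A], so the two are interchanged
    without conversion. *)
Definition smooth_at (E F : normedModType R) (M : chartedType E)
    (N : chartedType F) (f : M -> N) (p : M) :=
  {for p, continuous f} /\
  exists W : set E, [/\ open W, W (chart_map (chart_at p) p) &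
                        smooth_in W (read_in_charts f p)].

Section Tmap.
Context {E F : normedModType R} {M : chartedType E} {N : chartedType F}.
HB.instance Definition _ (f : M -> N) (p : M) :=
  GRing.Linear.copy (tmap f p)
    ('d (read_in_charts f p) (chart_map (chart_at p : chart E M) p)).
End Tmap.

Lemma good_charts_manifold (E : normedModType R) (M : manifoldType E) :
  good_charts M.
Proof. by move=> p; split; [exact: chart_atP | exact: mem_chart_at]. Qed.

Lemma is_chart_id (E : normedModType R) : is_chart (id_chart E).
Proof.
split=> //=; first exact: openT.
- by rewrite image_id; exact: openT.
- by move=> p _; exact: cvg_id.
- by move=> p _; exact: cvg_id.
Qed.

Lemma good_charts_mx m n : good_charts 'M[R]_(m, n).
Proof. by move=> p; split => //; exact: is_chart_id. Qed.

Lemma good_charts_regular : good_charts R^o.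
Proof. by move=> p; split => //; exact: is_chart_id. Qed.

Lemma open_setX (T U : topologicalType) (A : set T) (B : set U) :
  open A -> open B -> open (A `*` B).
Proof.
move=> Ao Bo; rewrite openE => -[x y] [/= Ax By].
by exists (A, B) => //; split; exact: open_nbhs_nbhs.
Qed.

Lemma good_charts_prod (E F : normedModType R) (M : chartedType E)
    (N : chartedType F) :
  good_charts M -> good_charts N -> good_charts (M * N)%type.
Proof.
move=> gM gN [p q]; have [[/= o1 o2 K c1 c2] d1] := gM p.
have [[/= o1' o2' K' c1' c2'] d1'] := gN q; split=> //; split=> /=.
- exact: open_setX.
- rewrite (_ : _ @` _ = (chart_map (chart_at p) @` chart_dom (chart_at p)) `*`
     (chart_map (chart_at q) @` chart_dom (chart_at q))); first exact: open_setX.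
  apply/seteqP; split=> [_ [[x y] [/= dx dy] <-]|[a b] [/= [x dx <-] [y dy <-]]].
    by split; [exists x | exists y].
  by exists (x, y).
- by move=> [x y] [/= dx dy]; rewrite K ?K'.
- move=> [x y] [/= dx dy]; apply: cvg_pair.
    by apply: (@continuous_comp _ _ _ fst); [exact: cvg_fst | exact: c1].
  by apply: (@continuous_comp _ _ _ snd); [exact: cvg_snd | exact: c1'].
- move=> _ [[x y] [/= dx dy] <-] /=; apply: cvg_pair.
    apply: (@continuous_comp _ _ _ fst); [exact: cvg_fst | apply: c2].
    by exists x.
  apply: (@continuous_comp _ _ _ snd); [exact: cvg_snd | apply: c2'].
  by exists y.
Qed.

Lemma power_proj_continuous (m : nat) (M : topologicalType) (i : 'I_m) :
  continuous (fun p : power m M => p i).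
Proof. exact: (@proj_continuous _ (fun=> M) i). Qed.

Lemma continuous_at_power (m : nat) (T M : topologicalType)
    (f : T -> power m M) (x : T) :
  (forall i, {for x, continuous (fun y => f y i)}) -> {for x, continuous f}.
Proof.
move=> fc; apply/cvg_sup => i A [? /= [[B oB <-]] Bfx /filterS]; apply.
by apply: fc; exact: open_nbhs_nbhs.
Qed.

(** Reduces continuity and smoothness of a matrix of row functions to the cases of sums and of
    linear maps. *)
Lemma col_rows (m d : nat) (r : 'I_m -> 'rV[R]_d) :
  \matrix_i r i = \sum_i delta_mx i (0 : 'I_1) *m r i.
Proof.
apply/row_matrixP => i; rewrite rowK raddf_sum (bigD1 i) //= big1 ?addr0.
  by rewrite row_mul rowE mul_delta_mx [delta_mx 0 0]mx11_scalar mxE mul1mx.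
move=> j ji; rewrite row_mul rowE mul_delta_mx_0 ?mul0mx //.
by rewrite eq_sym.
Qed.

Lemma continuous_at_rows (m d : nat) (T : topologicalType)
    (f : 'I_m -> T -> 'rV[R]_d) (x : T) :
  (forall i, {for x, continuous (f i)}) ->
  {for x, continuous (fun y => \matrix_i f i y)}.
Proof.
move=> fc; rewrite (_ : (fun _ => _) =
  (fun y => \sum_i mulmx (delta_mx i (0 : 'I_1)) (f i y))); last first.
  by apply/funext => y; rewrite col_rows.
apply: cvg_big => [|i _]; first exact: add_continuous.
apply: continuous_comp; first exact: fc.
exact: (linear_finite_coords_continuous (finite_coords_mx _ _)).
Qed.

Lemma row_continuous m d (i : 'I_m) : continuous (@row R m d i).
Proof. exact: (linear_finite_coords_continuous (finite_coords_mx _ _)). Qed.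

Lemma open_forall_preimage (T : topologicalType) (I : finType)
  (U : I -> topologicalType) (f : forall i, T -> U i) (D : forall i, set (U i)) :
  (forall i, continuous (f i)) -> (forall i, open (D i)) ->
  open [set x | forall i, D i (f i x)].
Proof.
move=> fc Do; rewrite openE => x Dx; apply: filter_forall => i.
by apply: fc; apply: open_nbhs_nbhs; split=> //; exact: Dx.
Qed.

Lemma good_charts_power (d m : nat) (M : chartedType 'rV[R]_d) :
  good_charts M -> good_charts (power m M).
Proof.
move=> gM p; split; last by move=> i; have [] := gM (p i).
pose D i := chart_dom (chart_at (p i) : chart 'rV[R]_d M).
split=> /=.
- apply: (@open_forall_preimage _ _ (fun=> M) (fun i (q : power m M) => q i) D) => i.
    exact: power_proj_continuous.
  by have [[]] := gM (p i).
- rewrite (_ : _ @` _ =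
      [set x | forall i, (chart_map (chart_at (p i)) @` D i) (row i x)]).
    apply: (@open_forall_preimage _ _ (fun=> 'rV[R]_d) (fun i => @row R m d i)
      (fun i => chart_map (chart_at (p i)) @` D i)) => i.
      exact: row_continuous.
    by have [[]] := gM (p i).
  apply/seteqP; split=> [_ [q Dq <-] i|x Dx].
    by exists (q i); [exact: Dq | rewrite rowK].
  have /choice[q qP] : forall i, exists y,
      D i y /\ chart_map (chart_at (p i)) y = row i x.
    by move=> i; have [y] := Dx i; exists y.
  exists q; first by move=> i; have [] := qP i.
  by apply/row_matrixP => i; rewrite rowK; have [] := qP i.
- move=> q Dq; apply/funext => i; rewrite rowK.
  by have [[_ _ K _ _] _] := gM (p i); exact: K.
- move=> q Dq; apply: continuous_at_rows => i.
  apply: continuous_comp; first exact: power_proj_continuous.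
  by have [[_ _ _ c _] _] := gM (p i); exact: c.
- move=> _ [q Dq <-]; apply: continuous_at_power => i.
  apply: continuous_comp; first exact: row_continuous.
  have [[_ _ _ _ c] _] := gM (p i); apply: c; rewrite rowK.
  by exists (q i).
Qed.

Section NearCharts.
Context {E : normedModType R} {M : chartedType E}.
Hypothesis gM : good_charts M.
Implicit Types p : M.

Lemma near_chart_at p : \forall q \near p, chart_dom (chart_at p : chart E M) q.
Proof. by have [[op _ _ _ _] d] := gM p; exact: open_nbhs_nbhs. Qed.

Lemma chart_mapK p (q : M) : chart_dom (chart_at p : chart E M) q ->
  chart_inv (chart_at p) (chart_map (chart_at p : chart E M) q) = q.
Proof. by have [[_ _ K _ _] _] := gM p; exact: K. Qed.

Lemma chart_atK p : chart_inv (chart_at p) (chart_map (chart_at p : chart E M) p) = p.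
Proof. by apply: chart_mapK; have [] := gM p. Qed.

Lemma chart_inv_continuous p :
  {for (chart_map (chart_at p : chart E M) p), continuous (chart_inv (chart_at p : chart E M))}.
Proof. by have [[_ _ _ _ c] d] := gM p; apply: c; exists p. Qed.

Lemma near_chart_inv p (P : M -> Prop) : (\forall q \near p, P q) ->
  \forall x \near (chart_map (chart_at p : chart E M) p),
    P (chart_inv (chart_at p : chart E M) x).
Proof. by move=> Pp; apply: chart_inv_continuous; rewrite /= chart_atK. Qed.

Lemma near_chart_invK p : \forall x \near (chart_map (chart_at p : chart E M) p),
  chart_map (chart_at p : chart E M) (chart_inv (chart_at p) x) = x.
Proof.
have [[_ op K _ _] d] := gM p.
have : \forall x \near (chart_map (chart_at p : chart E M) p),
    (chart_map (chart_at p : chart E M) @` chart_dom (chart_at p : chart E M)) x.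
  by apply: open_nbhs_nbhs; split=> //; exists p.
by apply: filterS => _ [q dq <-]; rewrite K.
Qed.

End NearCharts.

End Charts.

(** * Smooth maps and their tangent maps *)

Section SmoothAt.
Context {R : realType}.

Lemma Ck_in_pair (V W Z : normedModType R) n (A : set V) (f : V -> W)
    (g : V -> Z) : open A ->
  Ck_in n A f -> Ck_in n A g -> Ck_in n A (fun x => (f x, g x)).
Proof.
move=> Ao; elim: n f g => [|n IH] f g /=.
  by move=> fA gA x Ax; apply: cvg_pair; [exact: fA | exact: gA].
move=> [fd fA] [gd gA]; split=> [x Ax|v].
  by apply: differentiable_pair; [exact: fd | exact: gd].
apply: Ck_in_eq Ao _ (IH _ _ (fA v) (gA v)) => x; rewrite inE => Ax /=.
have := is_diff_pair (differentiableP (fd x Ax)) (differentiableP (gd x Ax)).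
move=> /(deriveE_is_diff v) ->; congr pair; apply: deriveE.
  exact: fd.
exact: gd.
Qed.

Lemma Ck_in_rows (V : normedModType R) n d m (A : set V)
    (f : 'I_m -> V -> 'rV[R]_d) : open A ->
  (forall i, Ck_in n A (f i)) -> Ck_in n A (fun x => \matrix_i f i x).
Proof.
move=> Ao fA; apply: (@Ck_in_eq _ _ _ _ _
  (fun x => \sum_i mulmx (delta_mx i (0 : 'I_1)) (f i x))) => //.
  by move=> x _; rewrite col_rows.
apply: Ck_in_sum => // i; apply: Ck_in_linear_comp => //.
exact: (linear_finite_coords_continuous (finite_coords_mx _ _)).
Qed.

Lemma smooth_atP (E F : normedModType R) (M : chartedType E) (N : chartedType F)
    (f : M -> N) (p : M) : {for p, continuous f} -> forall W,
  nbhs (chart_map (chart_at p : chart E M) p) W ->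
  (forall W', open W' -> W' `<=` W -> smooth_in W' (read_in_charts f p)) ->
  smooth_at f p.
Proof.
move=> fc W Wp fW; split=> //; exists W^°; split; first exact: open_interior.
- by [].
- by apply: fW; [exact: open_interior | exact: interior_subset].
Qed.

Section Comp.
Context {E F H : normedModType R}.
Context {M : chartedType E} {N : chartedType F} {P : chartedType H}.
Hypotheses (gM : good_charts M) (gN : good_charts N).
Implicit Types (f : M -> N) (g : N -> P) (p : M).

Lemma near_read_in_charts_comp f g p : {for p, continuous f} ->
  \forall x \near (chart_map (chart_at p : chart E M) p),
    read_in_charts g (f p) (read_in_charts f p x) = read_in_charts (g \o f) p x.
Proof.
move=> fc; have := near_chart_inv gM (fc _ (near_chart_at gN (f p))).
by apply: filterS => x /= dfx; rewrite /read_in_charts /= (chart_mapK gN).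
Qed.

Lemma near_eq_read_in_charts f f' p : {near p, f =1 f'} ->
  \forall x \near (chart_map (chart_at p : chart E M) p),
    read_in_charts f p x = read_in_charts f' p x.
Proof.
move=> ff; have := near_chart_inv gM ff.
by apply: filterS => x /= ffx; rewrite /read_in_charts /= ffx (nbhs_singleton ff).
Qed.

Lemma smooth_at_differentiable f p : smooth_at f p ->
  differentiable (read_in_charts f p) (chart_map (chart_at p : chart E M) p).
Proof. by move=> [_ [W [_ Wp /(_ 1)[/(_ _ Wp)]]]]. Qed.

Lemma tmap_near_eq f f' p :
  {near p, f =1 f'} -> smooth_at f p -> tmap f' p = tmap f p.
Proof.
move=> ff /smooth_at_differentiable/differentiableP fp.
by have [_] := near_eq_is_diff (near_eq_read_in_charts ff) fp.
Qed.

Lemma tmap_comp f g p : smooth_at f p -> smooth_at g (f p) ->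
  tmap (g \o f) p = tmap g (f p) \o tmap f p.
Proof.
move=> sf sg; have fc := sf.1.
have df := differentiableP (smooth_at_differentiable sf).
have : differentiable (read_in_charts g (f p))
    (chart_map (chart_at (f p) : chart F N) (f p)).
  by have [_ [W [_ Wp /(_ 1)[/(_ _ Wp)]]]] := sg.
move=> /differentiableP dg.
have E0 : read_in_charts f p (chart_map (chart_at p : chart E M) p) =
    chart_map (chart_at (f p) : chart F N) (f p).
  by rewrite /read_in_charts /= (chart_atK gM).
rewrite -E0 in dg; have [_ ] := near_eq_is_diff
  (near_read_in_charts_comp g fc) (@is_diff_comp _ _ _ _ _ _ _ _ _ df dg).
by rewrite E0.
Qed.

Lemma smooth_at_comp f g p : finite_coords F ->
  smooth_at f p -> smooth_at g (f p) -> smooth_at (g \o f) p.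
Proof.
move=> fF sf [gc [W2 [W2o W2p W2g]]]; have fd := smooth_at_differentiable sf.
have [fc [W1 [W1o W1p W1f]]] := sf.
have gfc : {for p, continuous (g \o f)} by exact: continuous_comp.
have E0 : read_in_charts f p (chart_map (chart_at p : chart E M) p) =
    chart_map (chart_at (f p) : chart F N) (f p).
  by rewrite /read_in_charts /= (chart_atK gM).
have W12 : \forall x \near (chart_map (chart_at p : chart E M) p),
    W2 (read_in_charts f p x).
  apply: (differentiable_continuous fd); apply: open_nbhs_nbhs; split=> //.
  by rewrite E0.
apply: (smooth_atP gfc (filterI (filterI (open_nbhs_nbhs (conj W1o W1p)) W12)
  (near_read_in_charts_comp g fc))) => W' W'o W'W n.
apply: (Ck_in_eq W'o) (Ck_in_comp fF W'o W2o _ (Ck_in_sub _ (W1f n)) (W2g n)).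
- by move=> x; rewrite inE => /W'W[].
- by move=> x /W'W[[]].
- by move=> x /W'W[[]].
Qed.

End Comp.

Lemma smooth_at_cst (E F : normedModType R) (M : chartedType E)
    (N : chartedType F) (a : N) (p : M) : smooth_at (cst a : M -> N) p.
Proof.
split; first exact: cvg_cst.
exists setT; split=> //; first exact: openT.
by move=> n; exact: (Ck_in_cst n setT (chart_map (chart_at a : chart F N) a)).
Qed.

Lemma tmap_cst (E F : normedModType R) (M : chartedType E)
  (N : chartedType F) (a : N) (p : M) u : tmap (cst a : M -> N) p u = 0.
Proof.
rewrite /tmap (_ : read_in_charts _ _ =
  cst (chart_map (chart_at a : chart F N) a)) //.
by rewrite diff_cst.
Qed.

(** The identity, the projections of a power and linear maps all become linear when read in charts;
    one argument gives both their smoothness and their tangent maps. *)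
Lemma linear_in_charts (E F : normedModType R) (M : chartedType E)
    (N : chartedType F) (L : {linear E -> F}) (f : M -> N) (p : M) :
  {for p, continuous f} -> continuous L ->
  (\forall x \near (chart_map (chart_at p : chart E M) p),
     L x = read_in_charts f p x) ->
  smooth_at f p /\ tmap f p = L.
Proof.
move=> fc Lc Lf; split.
  apply: (smooth_atP fc Lf) => W' W'o W'W n.
  by apply: (Ck_in_eq W'o) (Ck_in_linear n W' Lc) => x; rewrite inE => /W'W.
have [_ dL] := near_eq_is_diff Lf (differentiableP (linear_differentiable _ Lc)).
exact: etrans dL (diff_lin _ Lc).
Qed.

Lemma smooth_tmap_mx m n k l (L : {linear 'M[R]_(m, n) -> 'M[R]_(k, l)}) p :
  smooth_at L p /\ tmap L p = L.
Proof.
have Lc : continuous L.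
  exact: (linear_finite_coords_continuous (finite_coords_mx _ _)).
apply: linear_in_charts; [exact: Lc | exact: Lc |].
near=> x; reflexivity.
Unshelve. all: by end_near. Qed.

Lemma smooth_tmap_regular (L : {linear R^o -> R^o}) (p : R^o) :
  smooth_at (L : R^o -> R^o) p /\ tmap (L : R^o -> R^o) p = L.
Proof.
have Lc : continuous L.
  exact: (linear_finite_coords_continuous finite_coords_regular).
apply: linear_in_charts; [exact: Lc | exact: Lc |].
near=> x; reflexivity.
Unshelve. all: by end_near. Qed.

Section Basic.
Context {E F H : normedModType R}.
Context {M : chartedType E} {N : chartedType F} {P : chartedType H}.
Hypotheses (gM : good_charts M) (gN : good_charts N) (gP : good_charts P).

Lemma smooth_tmap_id (p : M) : smooth_at (@id M) p /\ tmap (@id M) p = id.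
Proof.
apply: (@linear_in_charts _ _ _ _ idfun (@id M)) => //.
- by move=> x; exact: cvg_id.
- by apply: filterS (near_chart_invK gM p).
Qed.

Lemma smooth_at_pair (f : M -> N) (g : M -> P) (p : M) :
  smooth_at f p -> smooth_at g p -> smooth_at (fun q => (f q, g q)) p.
Proof.
move=> [fc [W1 [W1o W1p W1f]]] [gc [W2 [W2o W2p W2g]]]; split.
  exact: cvg_pair.
exists (W1 `&` W2); split=> //; first exact: openI.
by move=> n; apply: Ck_in_pair; [exact: openI |
  apply: Ck_in_sub (W1f n) | apply: Ck_in_sub (W2g n)] => x [].
Qed.

Lemma tmap_pair (f : M -> N) (g : M -> P) (p : M) u :
  smooth_at f p -> smooth_at g p ->
  tmap (fun q => (f q, g q)) p u = (tmap f p u, tmap g p u).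
Proof.
move=> /smooth_at_differentiable fd /smooth_at_differentiable gd.
by rewrite /tmap (diff_pair fd gd).
Qed.

End Basic.

Section Power.
Context {d m : nat} {E : normedModType R}.
Context {M : chartedType E} {N : chartedType 'rV[R]_d}.
Hypotheses (gM : good_charts M) (gN : good_charts N).

Lemma smooth_tmap_proj (i : 'I_m) (p : power m N) :
  smooth_at (fun q : power m N => q i) p /\
  tmap (fun q : power m N => q i) p = row i.
Proof.
apply: (@linear_in_charts _ _ _ _ (row i) (fun q : power m N => q i)) => //.
- exact: power_proj_continuous.
- exact: row_continuous.
apply: filterS (near_chart_invK (good_charts_power gN) p) => x.
by move=> /(congr1 (row i)); rewrite rowK.
Qed.

Lemma smooth_at_power (f : M -> power m N) (p : M) :
  (forall i, smooth_at (fun q => f q i) p) -> smooth_at f p.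
Proof.
move=> sf; have fc : {for p, continuous f}.
  by apply: continuous_at_power => i; have [] := sf i.
have /choice[W WP] : forall i, exists W : set E,
    [/\ open W, W (chart_map (chart_at p) p) &
        smooth_in W (read_in_charts (fun q => f q i) p)].
  by move=> i; have [_] := sf i.
apply: (@smooth_atP _ _ _ _ _ _ fc [set x | forall i, W i x]).
  by apply: filter_forall => i; have [Wo Wp _] := WP i; exact: open_nbhs_nbhs.
move=> W' W'o W'W n.
apply: (@Ck_in_rows _ n _ _ W' (fun i => read_in_charts (fun q => f q i) p)) => //.
move=> i; have [_ _ /(_ n)] := WP i.
by apply: Ck_in_sub => x /W'W.
Qed.

Lemma row_tmap (f : M -> power m N) (p : M) u (i : 'I_m) : smooth_at f p ->
  row i (tmap f p u) = tmap (fun q => f q i) p u.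
Proof.
move=> sf; have [sp tp] := smooth_tmap_proj i (f p).
by rewrite -(tp) -[RHS]/(tmap ((fun q : power m N => q i) \o f) p u)
  (tmap_comp gM (good_charts_power gN) sf sp).
Qed.

End Power.

End SmoothAt.

(** * Calculus on a Lie group *)

Section LieMaps.
Context {R : realType} {d : nat} {G : lieGroupType R d}.
Implicit Types (p q a b : G) (X Y u v : 'rV[R]_d).

Lemma good_charts_lie : good_charts G.
Proof. exact: good_charts_manifold. Qed.

Lemma finite_coords_lie : finite_coords 'rV[R]_d.
Proof. exact: finite_coords_mx. Qed.

Section Maps.
Context {E : normedModType R} {M : chartedType E}.
Hypothesis gM : good_charts M.
Implicit Types (f g : M -> G) (x : M) (w : E).

Lemma smooth_at_mulg f g x : smooth_at f x -> smooth_at g x ->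
  smooth_at (fun y => f y * g y)%g x.
Proof.
move=> fx gx.
have gGG := good_charts_prod good_charts_lie good_charts_lie.
exact: (smooth_at_comp gM gGG (finite_coords_pair finite_coords_lie finite_coords_lie)
  (smooth_at_pair fx gx) (@mulg_smooth R d G (f x, g x) I)).
Qed.

Lemma smooth_at_invg f x : smooth_at f x -> smooth_at (fun y => (f y)^-1)%g x.
Proof.
move=> fx; exact: (smooth_at_comp gM good_charts_lie finite_coords_lie fx
  (@invg_smooth R d G (f x) I)).
Qed.

End Maps.

Lemma smooth_at_idG p : smooth_at (@id G) p.
Proof. by have [] := smooth_tmap_id good_charts_lie p. Qed.

End LieMaps.

Ltac smooth := repeat first
  [ assumption
  | exact: smooth_at_cst
  | exact: smooth_at_idG
  | apply: smooth_at_mulg; [first [exact: good_charts_lie | assumption] | | ]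
  | apply: smooth_at_invg; [first [exact: good_charts_lie | assumption] | ] ].

Section LieVelocities.
Context {R : realType} {d : nat} {G : lieGroupType R d}.
Implicit Types (p q a b : G) (X Y u v : 'rV[R]_d).

HB.instance Definition _ p := GRing.Linear.copy (@Ad R d G p)
  (tmap (fun x : G => (p * x * p^-1)%g) 1%g).
HB.instance Definition _ p := GRing.Linear.copy (@mc_left R d G p)
  (tmap (fun x : G => (p^-1 * x)%g) p).
HB.instance Definition _ p := GRing.Linear.copy (@mc_right R d G p)
  (tmap (fun x : G => (x * p^-1)%g) p).

Section TmapGroup.
Context {E : normedModType R} {M : chartedType E}.
Hypothesis gM : good_charts M.
Implicit Types (f g : M -> G) (x : M) (w : E).

Lemma tmapT f (h k : _ -> G) x w : smooth_at f x -> smooth_at (h : G -> G) (f x) ->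
  k = h \o f -> tmap h (f x) (tmap f x w) = tmap k x w.
Proof.
by move=> fx hx ->; rewrite (tmap_comp gM good_charts_lie).
Qed.

Lemma mc_right_tmap f x w : smooth_at f x ->
  mc_right (f x) (tmap f x w) = tmap (fun y => f y * (f x)^-1)%g x w.
Proof. by move=> fx; apply: tmapT => //; smooth. Qed.

Lemma Ad_tmap a f x w : smooth_at f x -> f x = 1%g ->
  Ad a (tmap f x w) = tmap (fun y => a * f y * a^-1)%g x w.
Proof. by move=> fx f1; rewrite /Ad -f1; apply: tmapT => //; smooth. Qed.

Lemma tmap_mulg_unit u v :
  tmap (fun p : G * G => (p.1 * p.2)%g) (1, 1)%g (u, v) = u + v.
Proof.
have gGG := good_charts_prod (@good_charts_lie R d G) (@good_charts_lie R d G).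
have m1 := @mulg_smooth R d G (1, 1)%g I.
have [_ idE] := smooth_tmap_id good_charts_lie (1%g : G).
have sl : smooth_at (fun y : G => (y, cst 1%g y : G)) 1%g.
  by apply: smooth_at_pair; smooth.
have sr : smooth_at (fun y : G => (cst 1%g y : G, y)) 1%g.
  by apply: smooth_at_pair; smooth.
(* By linearity it is enough to follow the two axes [(y, 1)] and [(1, y)], on which multiplication
   is the identity. *)
rewrite (_ : (u, v) = (u, 0) + (0, v)); last by rewrite -[RHS]/(_, _) addr0 add0r.
rewrite linearD; congr (_ + _).
  have -> : (u, 0) = tmap (fun y : G => (y, cst 1%g y : G)) 1%g u.
    by rewrite tmap_pair ?tmap_cst ?idE //; smooth.
  have := congr1 (@^~ u) (tmap_comp good_charts_lie gGG sl m1); rewrite /= => <-.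
  rewrite (_ : _ \o _ = id) ?idE //.
  by apply/funext => y /=; rewrite mulg1.
have -> : (0, v) = tmap (fun y : G => (cst 1%g y : G, y)) 1%g v.
  by rewrite tmap_pair ?tmap_cst ?idE //; smooth.
have := congr1 (@^~ v) (tmap_comp good_charts_lie gGG sr m1); rewrite /= => <-.
rewrite (_ : _ \o _ = id) ?idE //.
by apply/funext => y /=; rewrite mul1g.
Qed.

Lemma tmap_mulg1 f g x w : smooth_at f x -> smooth_at g x ->
  f x = 1%g -> g x = 1%g ->
  tmap (fun y => f y * g y)%g x w = tmap f x w + tmap g x w.
Proof.
move=> fx gx f1 g1.
have gGG := good_charts_prod (@good_charts_lie R d G) (@good_charts_lie R d G).
have m1 : smooth_at (fun p : G * G => (p.1 * p.2)%g) (f x, g x).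
  exact: mulg_smooth.
rewrite -[LHS]/(tmap ((fun p : G * G => (p.1 * p.2)%g) \o (fun y => (f y, g y))) x w).
rewrite (tmap_comp gM gGG (smooth_at_pair fx gx) m1) /= tmap_pair // f1 g1.
exact: tmap_mulg_unit.
Qed.

Lemma mc_right_cst a x w : mc_right a (tmap (cst a : M -> G) x w) = 0.
Proof. by rewrite tmap_cst linear0. Qed.

(** Translated to the unit, f(y) g(y) (f(x) g(x))^-1 is the product of f(y) f(x)^-1 and the
    conjugate of g(y) g(x)^-1 by f(x). Both factors are 1 at y = x, where a product differentiates
    to a sum. *)
Lemma mc_right_mulg f g x w : smooth_at f x -> smooth_at g x ->
  mc_right (f x * g x)%g (tmap (fun y => f y * g y)%g x w) =
  mc_right (f x) (tmap f x w) + Ad (f x) (mc_right (g x) (tmap g x w)).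
Proof.
move=> fx gx.
have s1 : smooth_at (fun y => f y * (f x)^-1)%g x by smooth.
have s2 : smooth_at (fun y => g y * (g x)^-1)%g x by smooth.
have s3 : smooth_at (fun y => f x * (g y * (g x)^-1) * (f x)^-1)%g x by smooth.
have s4 : smooth_at (fun y => f y * g y)%g x by smooth.
rewrite (mc_right_tmap _ s4) (mc_right_tmap _ fx) (mc_right_tmap _ gx).
rewrite (Ad_tmap _ _ s2) ?mulgV //.
have e1 : (f x * (f x)^-1)%g = 1%g by rewrite mulgV.
have e3 : (f x * (g x * (g x)^-1) * (f x)^-1)%g = 1%g by rewrite mulgV mulg1 mulgV.
have mE := tmap_mulg1 w s1 s3 e1 e3.
apply: etrans mE.
have -> // : (fun y => f y * g y * (f x * g x)^-1)%g =
  (fun y => f y * (f x)^-1 * (f x * (g y * (g x)^-1) * (f x)^-1))%g.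
by apply/funext => y; rewrite invgM !mulgA mulgVK.
Qed.

Lemma mc_right_invg f x w : smooth_at f x ->
  mc_right (f x)^-1%g (tmap (fun y => (f y)^-1)%g x w) =
  - Ad (f x)^-1%g (mc_right (f x) (tmap f x w)).
Proof.
move=> fx; have fVx : smooth_at (fun y => (f y)^-1)%g x by smooth.
(* The product rule for the constant map f^-1 f. *)
have := mc_right_mulg w fVx fx.
rewrite (_ : (fun y => _ * _)%g = cst 1%g) ?mulVg ?mc_right_cst.
  by move/esym/eqP; rewrite addr_eq0 => /eqP.
by apply/funext => y /=; rewrite mulVg.
Qed.

End TmapGroup.

Lemma tmap_idG p u : tmap (@id G) p u = u.
Proof. by have [_ ->] := smooth_tmap_id good_charts_lie p. Qed.

Lemma Ad1 X : Ad (1%g : G) X = X.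
Proof.
rewrite /Ad (_ : (fun x : G => _) = id) ?tmap_idG //.
by apply/funext => y; rewrite mul1g invg1 mulg1.
Qed.

Lemma Ad_central z X : centerg z -> Ad (z : G) X = X.
Proof.
move=> zc; rewrite /Ad (_ : (fun x : G => _) = id) ?tmap_idG //.
by apply/funext => y; rewrite -zc mulgK.
Qed.

Lemma AdM a b X : Ad (a * b)%g X = Ad a (Ad b X).
Proof.
have sb : smooth_at (fun y : G => b * y * b^-1)%g 1%g by smooth.
have b1 : (b * 1 * b^-1)%g = 1%g by rewrite mulg1 mulgV.
apply/esym/(etrans (Ad_tmap good_charts_lie a X sb b1)).
have -> // : (fun y : G => a * (b * y * b^-1) * a^-1)%g =
  (fun y => a * b * y * (a * b)^-1)%g.
by apply/funext => y; rewrite invgM !mulgA.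
Qed.

Lemma AdK a : cancel (@Ad R d G a) (Ad a^-1%g).
Proof. by move=> X; rewrite -AdM mulVg Ad1. Qed.

Lemma AdVK a : cancel (@Ad R d G a^-1%g) (Ad a).
Proof. by move=> X; rewrite -AdM mulgV Ad1. Qed.

Lemma mc_leftE p u : mc_left p u = Ad p^-1%g (mc_right p u).
Proof.
have sV : smooth_at (fun y : G => y * p^-1)%g p by smooth.
apply/esym/(etrans (Ad_tmap good_charts_lie p^-1%g u sV (mulgV p))).
have -> // : (fun y : G => p^-1 * (y * p^-1) * p^-1^-1)%g = (fun y => p^-1 * y)%g.
by apply/funext => y; rewrite invgK !mulgA mulgVK.
Qed.

Lemma mc_right_inj p u : mc_right p u = 0 -> u = 0.
Proof.
move=> u0; rewrite -(tmap_idG p u).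
have sp : smooth_at (fun y : G => (y * p^-1)%g) p by smooth.
have s1 : smooth_at (fun y : G => (y * p)%g) ((fun y : G => (y * p^-1)%g) p) by smooth.
have <- := tmapT good_charts_lie (k := id) u sp s1; last first.
  by apply/funext => y /=; rewrite mulgVK.
by rewrite -/(mc_right p u) u0 linear0.
Qed.

End LieVelocities.

(** * One-parameter subgroups *)

Section Constancy.
Context {R : realType}.

(** Each coordinate of [f] is a real function with zero derivative on an interval, where the mean
    value theorem applies. *)
Lemma near_diff0_near_cst (W : normedModType R) (f : R^o -> W) (t : R^o) :
  finite_coords W ->
  (\forall s \near t, differentiable f s /\ 'd f s 1 = 0) ->
  \forall s \near t, f s = f t.
Proof.
move=> [I [e [c [cc ce]]]] /nbhs_ballP[r /= r0 fr].
apply/nbhs_ballP; exists r => //= s ts.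
rewrite [LHS]ce [RHS]ce; apply: eq_bigr => i _; congr (_ *: _).
pose h (x : R) : R := c i (f x).
have hd (x : R) : ball (t : R^o) r x -> is_derive x (1 : R) (h : R -> R) 0.
  move=> /fr[fx f0].
  have hx := @is_diff_comp _ _ _ _ _ _ _ _ _ (differentiableP fx)
    (differentiableP (linear_differentiable (f x) (cc i))).
  apply: DeriveDef; first by apply: diff_derivable; exact: ex_diff.
  by rewrite (deriveE_is_diff _ hx) /= f0 linear0.
have ball_itv (x y z : R) : ball (t : R^o) r x -> ball (t : R^o) r y ->
    x <= z <= y -> ball (t : R^o) r z.
  rewrite -!ball_normE /= => bx yb /andP[xz zy].
  by move: bx yb; rewrite !ltr_norml => /andP[? ?] /andP[? ?]; apply/andP; split; lra.
have hcst (x y : R) : ball (t : R^o) r x -> ball (t : R^o) r y -> x <= y -> h y = h x.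
  move=> bx yb xy; have hz z : z \in `[x, y] -> is_derive z (1 : R) (h : R -> R) 0.
    by move=> zxy; apply/hd/(ball_itv x y).
  have hz' z : z \in `]x, y[ -> is_derive z (1 : R) (h : R -> R) 0.
    by move=> zxy; apply: hz; exact: subset_itv_oo_cc.
  have hc : {within `[x, y], continuous h}.
    apply: derivable_within_continuous.
    by move=> z zxy; have [] := hz z zxy.
  have [_ _] := MVT_segment xy hz' hc.
  by rewrite mul0r => /eqP; rewrite subr_eq0 => /eqP.
have tt : ball (t : R^o) r t by exact: ballxx.
by have [ts'|st'] := lerP t s; [exact: hcst | apply/esym/hcst => //; exact: ltW].
Qed.

(** The set where [f] agrees with [f 0] is open and closed in the connected line. *)
Lemma locally_constant_regular (T : Type) (f : R^o -> T) :
  (forall t : R^o, \forall s \near t, f s = f t) -> forall t, f t = f 0.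
Proof.
move=> fl; have Tc : connected [set: R] by apply/connected_intervalP => x y.
have op (D : set R) : (forall s, D s -> nbhs (s : R^o) D) -> open (D : set R).
  by rewrite openE.
pose A : set R := [set s | f s = f 0].
have A_open : open A.
  by apply: op => s fs; by apply: filterS (fl s) => x /= fx; rewrite /A /= fx.
have A_closed : closed A.
  rewrite -openC; apply: op => s fs; apply: filterS (fl s) => x /= fx fx0.
  by apply: fs; rewrite /A /= -fx.
have AT : A = setT.
  apply: Tc; first by exists 0.
    by exists A => //; rewrite setTI.
  by exists A => //; rewrite setTI.
by move=> t; have : A t by rewrite AT.
Qed.

End Constancy.

Section OneParam.
Context {R : realType} {d : nat} {G : lieGroupType R d}.
Implicit Types (p q a b : G) (X Y u v : 'rV[R]_d) (c : R^o -> G) (s t : R^o).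

Let gR := @good_charts_regular R.

(** Read in the chart preferred at [p], the chart of [q] is a transition map of the atlas. This
    allows a curve to be followed in one fixed chart, although [tmap] uses at each point the chart
    of that point. *)
Lemma smooth_at_chart_map (q p : G) :
  chart_dom (chart_at q : chart 'rV[R]_d G) p ->
  smooth_at (chart_map (chart_at q : chart 'rV[R]_d G) : G -> 'rV[R]_d) p.
Proof.
move=> dp; have gG := @good_charts_lie R d G.
have [[qo _ _ cq _] _] := gG q.
have qp : \forall x \near p, chart_dom (chart_at q : chart 'rV[R]_d G) x.
  exact: open_nbhs_nbhs.
have cW : \forall x \near chart_map (chart_at p : chart 'rV[R]_d G) p,
    (chart_map (chart_at p) @` (chart_dom (chart_at p) `&`
      chart_dom (chart_at q : chart 'rV[R]_d G))) x.
  have cp : \forall x \near chart_map (chart_at p : chart 'rV[R]_d G) p,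
      (chart_dom (chart_at p : chart 'rV[R]_d G) `&`
       chart_dom (chart_at q : chart 'rV[R]_d G)) (chart_inv (chart_at p) x).
    by apply: (near_chart_inv gG); apply: filterI => //; exact: near_chart_at.
  near=> x; exists (chart_inv (chart_at p : chart 'rV[R]_d G) x).
    by near: x.
  by near: x; exact: (near_chart_invK gG p).
apply: (smooth_atP _ cW); first exact: cq.
move=> W' _ W'W n; exact: (Ck_in_sub W'W (chart_at_compat p q n)).
Unshelve. all: by end_near. Qed.

Lemma tmap0_cst c : (forall t, smooth_at c t) -> (forall t, tmap c t 1 = 0) ->
  forall t, c t = c 0.
Proof.
move=> cs c0; apply: locally_constant_regular => t.
have gG := @good_charts_lie R d G.
pose f : R^o -> 'rV[R]_d := chart_map (chart_at (c t)) \o c.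
have ct : \forall s \near t, chart_dom (chart_at (c t) : chart 'rV[R]_d G) (c s).
  by have [cc _] := cs t; exact: (cc _ (near_chart_at gG (c t))).
have fc : \forall s \near t, f s = f t.
  apply: near_diff0_near_cst; first exact: finite_coords_mx.
  apply: filterS ct => s dcs; have ms := smooth_at_chart_map dcs.
  have sf := smooth_at_comp gR gG finite_coords_lie (cs s) ms.
  split; first exact: (smooth_at_differentiable sf).
  rewrite -[LHS]/(tmap f s 1) (tmap_comp gR gG (cs s) ms) /= c0.
  exact: linear0.
apply: filterS (filterI ct fc) => s [/= ds fs].
rewrite -[LHS](chart_mapK gG ds) -[RHS](chart_atK gG (c t)).
by congr (chart_inv _ _).
Qed.

Lemma smooth_tmap_shift (s t : R^o) :
  smooth_at (fun x : R^o => x + s : R^o) t /\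
  tmap (fun x : R^o => x + s : R^o) t = id.
Proof.
have cd : is_diff t (fun x : R^o => x + s : R^o) id.
  by apply: is_diff_eq; rewrite addr0.
split; last by have [_] := cd.
split; first by apply: differentiable_continuous; exact: ex_diff.
exists setT; split=> //; first exact: openT.
move=> n; apply: (Ck_inD openT); last exact: Ck_in_cst.
by apply: (Ck_in_linear n setT (f := idfun)) => x; exact: cvg_id.
Qed.

Section Subgroup.
Variables (c : R^o -> G) (X : 'rV[R]_d).
Hypothesis cX : one_param_subgroup X c.

Let cs t : smooth_at c t. Proof. by have [/(_ t I)] := cX. Qed.
Let cD s t : c (s + t) = (c s * c t)%g. Proof. by have [_ ->] := cX. Qed.

Lemma one_param0 : c 0 = 1%g.
Proof. by apply: (mulgI (c 0)); rewrite -cD addr0 mulg1. Qed.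

Lemma one_paramN t : c (- t) = (c t)^-1%g.
Proof. by apply: (mulgI (c t)); rewrite -cD subrr one_param0 mulgV. Qed.

Lemma mc_right_one_param t : mc_right (c t) (tmap c t 1) = X.
Proof.
have [_ _ <-] := cX; have [sh th] := smooth_tmap_shift (- t) t.
rewrite (mc_right_tmap gR _ (cs t)).
rewrite (_ : (fun s => _) = c \o (fun s => s - t)); last first.
  by apply/funext => s /=; rewrite cD one_paramN.
by rewrite (tmap_comp gR gR sh (cs _)) /= th subrr.
Qed.

Lemma Ad_one_param t : Ad (c t) X = X.
Proof.
have [_ _ cX0] := cX; rewrite -{1}cX0 (Ad_tmap gR _ _ (cs 0) one_param0) -cX0.
have -> // : (fun s => c t * c s * (c t)^-1)%g = c.
by apply/funext => s; rewrite -one_paramN -!cD addrAC subrr add0r.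
Qed.

End Subgroup.

(** The curve c(s) c'(s)^-1 has right-translated velocity X - Ad(c(s) c'(s)^-1) X, which is 0
    because each subgroup fixes its own generator X under [Ad]. So the curve stays at its initial
    value 1. *)
Lemma one_param_unique X c c' :
  one_param_subgroup X c -> one_param_subgroup X c' -> c = c'.
Proof.
move=> cX c'X; apply/funext => t.
have cs s : smooth_at c s by have [/(_ s I)] := cX.
have cs' s : smooth_at c' s by have [/(_ s I)] := c'X.
have w0 : forall s, (c s * (c' s)^-1)%g = 1%g.
  move=> s; rewrite (@tmap0_cst (fun x => c x * (c' x)^-1)%g).
  - by rewrite (one_param0 cX) (one_param0 c'X) invg1 mulg1.
  - by move=> x; smooth.
  move=> x; apply: (@mc_right_inj _ _ _ (c x * (c' x)^-1)%g).
  rewrite (mc_right_mulg gR) //; last by smooth.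
  rewrite (mc_right_invg gR) // (mc_right_one_param cX) (mc_right_one_param c'X).
  rewrite -{2}(Ad_one_param c'X x) AdK linearN /= (Ad_one_param cX).
  by rewrite subrr.
by apply: (mulIg (c' t)^-1%g); rewrite w0 mulgV.
Qed.

Lemma exp_one_param X c : one_param_subgroup X c -> exp X = c 1.
Proof.
move=> cX; rewrite /exp; case: xgetP => [c' _ c'X|/(_ c)//].
by rewrite (one_param_unique c'X cX).
Qed.

Lemma one_paramZ X c (k : R) : one_param_subgroup X c ->
  one_param_subgroup (k *: X) (fun t => c (k * t)).
Proof.
move=> cX; have [cs cD c0] := cX.
pose L : {linear R^o -> R^o} := *:%R k.
have sL t := (smooth_tmap_regular L t).1.
have tL t := (smooth_tmap_regular L t).2.
have sc t : smooth_at c t by exact: (cs t I).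
split=> [t _|s t|].
- exact: (smooth_at_comp gR gR (@finite_coords_regular R) (sL t) (sc _)).
- by rewrite mulrDr cD.
rewrite -[LHS]/(tmap (c \o L) 0 1).
rewrite (tmap_comp gR gR (sL 0) (sc _)) /= tL linear0.
by rewrite -c0 -linearZ.
Qed.

Lemma one_param_Ad X c p : one_param_subgroup X c ->
  one_param_subgroup (Ad p X) (fun t => p * c t * p^-1)%g.
Proof.
move=> cX; have [cs cD c0] := cX.
have sc t : smooth_at c t by exact: (cs t I).
split=> [t _|s t|].
- by have : smooth_at (fun t => p * c t * p^-1)%g t by smooth.
- by rewrite cD !mulgA mulgVK.
- by rewrite -c0 (Ad_tmap gR) // (one_param0 cX).
Qed.

Lemma one_param_0 : one_param_subgroup (0 : 'rV[R]_d) (fun=> 1%g : G).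
Proof.
split=> [t _|s t|].
- exact: (@smooth_at_cst _ _ _ R^o G 1%g t).
- by rewrite mulg1.
- exact: (@tmap_cst _ _ _ R^o G 1%g).
Qed.

Lemma exp0 : exp (0 : 'rV[R]_d) = 1%g :> G.
Proof. exact: exp_one_param one_param_0. Qed.

Lemma expZ X c k : one_param_subgroup X c -> exp (k *: X) = c k.
Proof.
by move=> cX; rewrite (exp_one_param (one_paramZ k cX)) mulr1.
Qed.

Section ExpDomain.
Variable O : set 'rV[R]_d.
Hypothesis O_domain : exp_domain (G := G) O.

Lemma exp_inj_domain X Y : O X -> O Y -> exp X = exp Y :> G -> X = Y.
Proof.
have [_ _ _ _ [_ _ [h [_ hK]]]] := O_domain.
by move=> OX OY e; rewrite -(hK X) ?inE // e hK // inE.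
Qed.

(* [exp] takes the junk value [1 = exp 0] where there is no one-parameter
   subgroup, and it is injective on [O]. *)
Lemma one_param_exists X : O X -> exists c : R^o -> G, one_param_subgroup X c.
Proof.
move=> OX; have [_ _ O0 _ _] := O_domain; apply: contrapT => noc.
have X0 : X = 0.
  apply: exp_inj_domain => //; rewrite exp0 /exp; case: xgetP => // c _ cX.
  by exfalso; apply: noc; exists c.
by apply: noc; rewrite X0; exists (fun=> 1%g); exact: one_param_0.
Qed.

Lemma expN X : O X -> exp (- X) = (exp X)^-1%g :> G.
Proof.
move=> /one_param_exists[c cX].
by rewrite -scaleN1r (expZ _ cX) (one_paramN cX) (exp_one_param cX).
Qed.

Lemma exp_half X : O X -> (exp (2^-1 *: X) * exp (2^-1 *: X))%g = exp X :> G.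
Proof.
move=> /one_param_exists[c cX]; have [_ cD _] := cX.
rewrite (expZ _ cX) (exp_one_param cX) -cD; congr c.
by rewrite -[LHS]/(2^-1 + 2^-1 : R); field.
Qed.

Lemma exp_Ad p X : O X -> exp (Ad p X) = (p * exp X * p^-1)%g.
Proof.
move=> /one_param_exists[c cX].
by rewrite (exp_one_param (one_param_Ad p cX)) (exp_one_param cX).
Qed.

End ExpDomain.

End OneParam.

(** * Local charts of submanifolds *)

Section LocalChart.
Context {R : realType}.

(* [f] parametrizes [S `&` D] by [W], and the inverse of [f] extends to a smooth
   map [h] on the open set [D]. *)
Definition local_chart (E : normedModType R) (M : chartedType E) (k : nat)
    (S : set M) (W : set 'rV[R]_k) (D : set M) (f : 'rV[R]_k -> M)
    (h : M -> 'rV[R]_k) :=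
  [/\ open W /\ open D, smooth_on W f, smooth_on D h,
      (forall x, W x -> [/\ S (f x), D (f x) & h (f x) = x]) &
      (forall y, S y -> D y -> W (h y) /\ f (h y) = y)].

Section Criterion.
Context {E : normedModType R} {M : chartedType E} {k : nat}.
Hypothesis gM : good_charts M.
Implicit Types (S V : set M) (W : set 'rV[R]_k).

(** The extended inverse [h] settles everything: [tmap h] is a left inverse of [tmap f], and the
    image of an open [W'] is cut out of [S] by the open set of points of [D] that [h] sends into
    [W']. *)
Lemma local_chart_param S W D (f : 'rV[R]_k -> M) h :
  local_chart S W D f h -> local_param S W f.
Proof.
move=> [[Wo Do] fs hs fW hD]; split=> //.
- move=> x y; rewrite !inE => /fW[_ _ hx] /fW[_ _ hy] fxy.
  by rewrite -hx fxy hy.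
- move=> x Wx; apply: (can_inj (g := tmap h (f x))) => u.
  have [_ Dfx _] := fW _ Wx.
  have gr := @good_charts_mx R 1 k.
  have E0 := congr1 (@^~ u) (tmap_comp gr gM (fs x Wx) (hs _ Dfx)).
  rewrite /= in E0; rewrite -E0.
  have [sid tid] := smooth_tmap_id gr x.
  have id_near : {near x, @id 'rV[R]_k =1 h \o f}.
    apply: filterS (open_nbhs_nbhs (conj Wo Wx)) => y /fW[_ _ /= hy].
    by rewrite hy.
  by rewrite (tmap_near_eq gr id_near sid) tid.
- move=> W' W'o W'W; exists (D `&` h @^-1` W').
    rewrite openE => y [Dy W'hy]; apply: filterI; first exact: open_nbhs_nbhs.
    have [hc _] := hs _ Dy; apply: hc; exact: open_nbhs_nbhs.
  apply/seteqP; split=> [_ [x W'x <-]|y [Sy [Dy W'hy]]].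
    by have [? ? hx] := fW _ (W'W _ W'x); split=> //; split=> //=; rewrite hx.
  by exists (h y) => //; have [] := hD _ Sy Dy.
Qed.

Lemma local_chart_submanifold S :
  (forall p, S p -> exists W D (f : 'rV[R]_k -> M) h, local_chart S W D f h /\ D p) ->
  submanifold k S.
Proof.
move=> Sp p /[dup] Spp /Sp[W [D [f [h [c Dp]]]]].
have [_ _ _ _ hD] := c; have [Whp fhp] := hD _ Spp Dp.
by exists W, f, (h p); split=> //; exact: local_chart_param c.
Qed.

Lemma local_chart_restrict S V W D (f : 'rV[R]_k -> M) h : open V ->
  local_chart S W D f h -> local_chart (S `&` V) (W `&` f @^-1` V) (D `&` V) f h.
Proof.
move=> Vo [[Wo Do] fs hs fW hD]; split.
- split; last exact: openI.
  rewrite openE => x [Wx Vfx]; apply: filterI; first exact: open_nbhs_nbhs.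
  by have [fc _] := fs _ Wx; apply: fc; exact: open_nbhs_nbhs.
- by move=> x [Wx _]; exact: fs.
- by move=> y [Dy _]; exact: hs.
- by move=> x [Wx Vfx]; have [] := fW _ Wx.
- move=> y [Sy _] [Dy Vy]; have [Whx fhy] := hD _ Sy Dy.
  by split=> //; split=> //=; rewrite fhy.
Qed.

End Criterion.

(** [i] and [r] are mutually inverse only between [S] and [S']. Since [r] is smooth on the whole
    ambient space, the inverse of the new parametrization still extends to an open set. This carries
    charts of C^n to the images of [Lambda]. *)
Lemma local_chart_map (E F : normedModType R) (M : chartedType E)
    (N : chartedType F) k (S : set M) (S' : set N) (W : set 'rV[R]_k) D f h
    (i : M -> N) (r : N -> M) :
  good_charts M -> good_charts N -> finite_coords E ->
  (forall p, smooth_at i p) -> (forall q, smooth_at r q) ->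
  (forall p, S p -> S' (i p) /\ r (i p) = p) ->
  (forall q, S' q -> S (r q) /\ i (r q) = q) ->
  local_chart S W D f h -> local_chart S' W (r @^-1` D) (i \o f) (h \o r).
Proof.
move=> gM gN fE si sr iS rS [[Wo Do] fs hs fW hD]; split.
- split=> //; rewrite openE => y Dy.
  by have [rc _] := sr y; apply: rc; exact: open_nbhs_nbhs.
- move=> x Wx.
  exact: (smooth_at_comp (@good_charts_mx R 1 k) gM fE (fs _ Wx) (si _)).
- by move=> y Dy; exact: (smooth_at_comp gN gM fE (sr _) (hs _ Dy)).
- by move=> x /fW[Sfx Dfx hfx]; have [? E0] := iS _ Sfx; split=> //=; rewrite E0.
- by move=> y /rS[Sry iry] Dry; have [? E0] := hD _ Sry Dry; split=> //=; rewrite E0.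
Qed.

Lemma smooth_at_rows (E : normedModType R) (M : chartedType E) (m k : nat)
    (f : 'I_m -> M -> 'rV[R]_k) (p : M) :
  (forall i, smooth_at (f i) p) -> smooth_at (fun q => \matrix_i f i q) p.
Proof.
move=> sf; have fc : {for p, continuous (fun q => \matrix_i f i q)}.
  by apply: continuous_at_rows => i; have [] := sf i.
have /choice[W WP] : forall i, exists W : set E,
    [/\ open W, W (chart_map (chart_at p) p) & smooth_in W (read_in_charts (f i) p)].
  by move=> i; have [_] := sf i.
apply: (@smooth_atP _ _ _ _ _ _ _ fc [set x | forall i, W i x]).
  by apply: filter_forall => i; have [Wo Wp _] := WP i; exact: open_nbhs_nbhs.
move=> W' W'o W'W n.
apply: (@Ck_in_rows _ _ n _ _ W' (fun i => read_in_charts (f i) p)) => //.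
by move=> i; have [_ _ /(_ n)] := WP i; apply: Ck_in_sub => x /W'W.
Qed.

Section PowerChart.
Context {d m k : nat} {M : chartedType 'rV[R]_d}.
Hypothesis gM : good_charts M.

(** Parameters of a submanifold are row vectors, hence the flattening of an m by k matrix with
    [mxvec]. *)
Lemma local_chart_power (C : set M) (p : power m M)
    (W : 'I_m -> set 'rV[R]_k) (D : 'I_m -> set M) (f : 'I_m -> 'rV[R]_k -> M)
    (h : 'I_m -> M -> 'rV[R]_k) :
  (forall i, local_chart C (W i) (D i) (f i) (h i)) ->
  local_chart (cpower C)
    [set x : 'rV[R]_(m * k) | forall i, W i (row i (vec_mx x))]
    [set y : power m M | forall i, D i (y i)]
    (fun x => (fun i => f i (row i (vec_mx x))) : power m M)
    (fun y => mxvec (\matrix_i h i (y i))).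
Proof.
move=> c; have gr := @good_charts_mx R 1 (m * k); have gr' := @good_charts_mx R 1 k.
have gP := good_charts_power (m := m) gM.
have rvs (i : 'I_m) (x : 'rV[R]_(m * k)) :
    smooth_at (fun x : 'rV[R]_(m * k) => row i (vec_mx x) : 'rV[R]_k) x.
  by have [] := @smooth_tmap_mx R _ _ _ _ (row i \o vec_mx) x.
have hrow y i : row i (vec_mx (mxvec (\matrix_i h i (y i)))) = h i (y i).
  by rewrite mxvecK rowK.
split.
- split.
    apply: (@open_forall_preimage _ _ (fun=> 'rV[R]_k)
      (fun i (x : 'rV[R]_(m * k)) => row i (vec_mx x)) W) => i.
      by move=> x; have [] := rvs i x.
    by have [[]] := c i.
  apply: (@open_forall_preimage _ _ (fun=> M) (fun i (q : power m M) => q i) D) => i.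
    exact: power_proj_continuous.
  by have [[]] := c i.
- move=> x Wx; apply: smooth_at_power => i.
  have [_ fs _ _ _] := c i.
  exact: (smooth_at_comp gr gr' (finite_coords_mx _ _) (rvs i x) (fs _ (Wx i))).
- move=> y Dy.
  have s : smooth_at (fun y : power m M => (\matrix_i h i (y i) : 'M[R]_(m, k))) y.
    apply: smooth_at_rows => i; have [_ _ hs _ _] := c i.
    have [sp _] := smooth_tmap_proj gM i y.
    exact: (smooth_at_comp gP gM (finite_coords_mx _ _) sp (hs _ (Dy i))).
  have [sv _] := @smooth_tmap_mx R _ _ _ _ (@mxvec R m k) (\matrix_i h i (y i)).
  exact: (smooth_at_comp gP (@good_charts_mx R m k) (finite_coords_mx _ _) s sv).
- move=> x Wx; split=> [i|i|].
  + by have [_ _ _ /(_ _ (Wx i))[]] := c i.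
  + by have [_ _ _ /(_ _ (Wx i))[]] := c i.
  + rewrite -[RHS]vec_mxK; congr mxvec; apply/row_matrixP => i; rewrite rowK.
    by have [_ _ _ /(_ _ (Wx i))[]] := c i.
- move=> y Cy Dy; split=> [i|].
    by rewrite hrow; have [_ _ _ _ /(_ _ (Cy i) (Dy i))[]] := c i.
  apply/funext => i; rewrite hrow.
  by have [_ _ _ _ /(_ _ (Cy i) (Dy i))[]] := c i.
Qed.

End PowerChart.

End LocalChart.

(** * Conjugacy classes of square roots of central elements *)

Section Class.
Context {R : realType} {d : nat} {G : lieGroupType R d}.
Implicit Types (p q g : G) (X Y : 'rV[R]_d).
Variable (C : set G).
Hypothesis C_class : conjugacy_class C.

Lemma class_conj g q : C q -> C (g * q * g^-1)%g.
Proof.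
have [p ->] := C_class; move=> [h _ <-]; exists (g * h)%g => //.
by rewrite invgM !mulgA.
Qed.

Lemma class_transitive p q : C p -> C q -> exists g, q = (g * p * g^-1)%g.
Proof.
have [r ->] := C_class; move=> [h _ <-] [k _ <-]; exists (k * h^-1)%g.
by rewrite invgM invgK !mulgA !mulgVK.
Qed.

Hypothesis C_square : forall p, C p -> centerg (p * p)%g.

(** Squaring commutes with conjugation, and conjugation fixes the central element p^2. Membership in
    C thus implies an equation, which is what gets differentiated or solved for a logarithm. *)
Lemma class_sq p q : C p -> C q -> (p * p)%g = (q * q)%g.
Proof.
move=> Cp Cq; have [g ->] := class_transitive Cp Cq.
rewrite !mulgA mulgVK -[(g * p * p)%g]mulgA.
by have zp := C_square Cp; rewrite (zp g) mulgK.
Qed.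

Lemma Ad_class_invol q X : C q -> Ad q (Ad q X) = X.
Proof. by move=> Cq; rewrite -AdM Ad_central //; exact: C_square. Qed.

Variable O : set 'rV[R]_d.
Hypothesis O_domain : exp_domain (G := G) O.

(* [exp Y * q] is the conjugate of [q] by [exp (Y / 2)] *)
Lemma exp_mul_class q Y : C q -> O Y -> Ad q Y = - Y -> C (exp Y * q)%g.
Proof.
move=> Cq OY qY; have [_ _ _ Ostar _] := O_domain.
have OY2 : O (2^-1 *: Y).
  by apply: Ostar => //; rewrite invr_ge0 ler0n invf_le1 ?ler1n ?ltr0n.
have qeV : (q * (exp (2^-1 *: Y))^-1 * q^-1)%g = exp (2^-1 *: Y) :> G.
  have := exp_Ad O_domain q OY2.
  rewrite linearZ /= qY scalerN (expN O_domain OY2) => /(congr1 (fun x : G => x^-1)%g).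
  by rewrite /= !invgM !invgK mulgA => /esym.
(* With e = exp(Y/2), exp(Y) q = e e q, and replacing the second e by q e^-1 q^-1 leaves e q
   e^-1. *)
rewrite -(exp_half O_domain) // -{2}qeV !mulgA mulgVK.
exact: class_conj.
Qed.

(** Cancelling q in (exp(Y) q)^2 = q^2 gives exp(Y) q exp(Y) = q, that is exp(Ad(q) Y) = exp(Y)^-1 =
    exp(-Y). Concluding by injectivity of [exp] requires -Y to lie in [O] as well. *)
Lemma log_class q Y : C q -> O Y -> O (- Y) -> C (exp Y * q)%g -> Ad q Y = - Y.
Proof.
move=> Cq OY ONY CYq; have [_ OAd _ _ _] := O_domain.
apply: (exp_inj_domain O_domain) => //; first exact: OAd.
rewrite (exp_Ad O_domain) // (expN O_domain) //.
have := class_sq CYq Cq; rewrite !mulgA => /mulIg Yq.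
apply: (mulgI (exp Y)); rewrite mulgV !mulgA.
by rewrite Yq mulgV.
Qed.

(** [a] parametrizes the (-1)-eigenspace of Ad(q). A basis is fixed at one point p of the class and
    transported by Ad(g) to q = g p g^-1, so that a single dimension [c] serves all points. *)
Lemma class_eigenspace : exists c : nat, forall q, C q ->
  exists (a : {linear 'rV[R]_c -> 'rV[R]_d}) (b : {linear 'rV[R]_d -> 'rV[R]_c}),
  [/\ cancel a b, (forall v : 'rV[R]_c, Ad q (a v) = - a v) &
      (forall Y, Ad q Y = - Y -> a (b Y) = Y)].
Proof.
have [p CE] := C_class.
have Cp : C p by rewrite CE; exists 1%g => //; rewrite mul1g invg1 mulg1.
pose V := eigenspace (lin1_mx (@Ad R d G p)) (-1).
pose A := row_base V.
have AV v : Ad p (v *m A) = - (v *m A).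
  have : (v *m A <= V)%MS by rewrite mulmx_sub // eq_row_base.
  by move/eigenspaceP; rewrite mul_rV_lin1 scaleN1r.
exists (\rank V) => q Cq; have [g qE] := class_transitive Cp Cq.
exists (Ad g \o mulmxr A), (mulmxr (pinvmx A) \o Ad g^-1%g).
split=> [v|v|Y qY] /=.
- by rewrite AdK mulmxKp // /A; exact: row_base_free.
- by rewrite qE -AdM mulgVK AdM AV linearN.
have pY : Ad p (Ad g^-1%g Y) = - Ad g^-1%g Y.
  by rewrite -linearN /= -qY qE -!AdM !mulgA mulVg mul1g.
rewrite mulmxKpV ?AdVK // eq_row_base; apply/eigenspaceP.
by rewrite mul_rV_lin1 /= pY scaleN1r.
Qed.

Lemma class_local_chart : exists c : nat, forall q, C q ->
  exists (W : set 'rV[R]_c) D (f : 'rV[R]_c -> G) h, local_chart C W D f h /\ D q.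
Proof.
have [c cP] := class_eigenspace; exists c => q Cq.
have [a [b [aK aN bK]]] := cP q Cq.
have [Oo _ O0 _ [exps expOo [log [logs expK]]]] := O_domain.
have gG := @good_charts_lie R d G; have gr := @good_charts_mx R 1 c.
have gd := @good_charts_mx R 1 d.
have logK z : (exp @` O) z -> exp (log z) = z /\ O (log z).
  by move=> [X OX <-]; rewrite expK ?inE.
(* The condition on the opposite of the logarithm is what [log_class] needs in order to put the
   logarithm of y q^-1 in the eigenspace. *)
pose D : set G := [set y | (exp @` O) (y * q^-1)%g /\ O (- log (y * q^-1))%g].
have sq y : smooth_at (fun y : G => y * q^-1)%g y by smooth.
have slog y : (exp @` O) (y * q^-1)%g -> smooth_at (fun y => log (y * q^-1)%g) y.
  by move=> Oy; exact: (smooth_at_comp gG gG finite_coords_lie (sq y) (logs _ Oy)).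
exists [set v : 'rV[R]_c | O (a v) /\ O (- a v)], D, (fun v => exp (a v) * q)%g,
  (fun y => b (log (y * q^-1)%g)); split; last first.
  by split; rewrite /= mulgV -exp0; [exists 0 | rewrite expK ?inE // oppr0].
have ONo : open [set Y | O (- Y)].
  by apply: open_comp Oo => Y _; exact: opp_continuous.
have OONo : open [set Y | O Y /\ O (- Y)] by exact: openI.
have sa (v : 'rV[R]_c) : smooth_at a v by have [] := smooth_tmap_mx a v.
have sb Y : smooth_at b Y by have [] := smooth_tmap_mx b Y.
split.
- split; rewrite openE.
    move=> v OaV; have [ac _] := sa v.
    exact: (ac _ (open_nbhs_nbhs (conj OONo OaV))).
  move=> y [Oy ONy]; apply: filterI.
    by have [yc _] := sq y; apply: yc; exact: open_nbhs_nbhs.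
  have [lc _] := slog y Oy.
  exact: (lc _ (open_nbhs_nbhs (conj ONo ONy))).
- move=> v [Ov _]; apply: smooth_at_mulg => //; last exact: smooth_at_cst.
  exact: (smooth_at_comp gr gd finite_coords_lie (sa v) (exps _ Ov)).
- move=> y [Oy _].
  exact: (smooth_at_comp gG gd finite_coords_lie (slog y Oy) (sb _)).
- move=> v [Ov ONv]; have lE : log (exp (a v) * q * q^-1)%g = a v.
    by rewrite mulgK expK ?inE.
  split; [exact: exp_mul_class | | by rewrite lE].
  by split; rewrite ?lE //= mulgK; exists (a v).
move=> y Cy [/[dup] Oy /logK[eE OlE] ONy].
have yE : y = (exp (log (y * q^-1)%g) * q)%g by rewrite eE mulgVK.
have lN : Ad q (log (y * q^-1)%g) = - log (y * q^-1)%g.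
  by apply: log_class => //; rewrite -yE.
by rewrite /= bK.
Qed.

End Class.

(** * Braids and partial products *)

Section PartialProducts.
Context {m : nat} {G : groupType}.
Implicit Types (p q : power m G) (k : 'I_m.-1) (w : braid_word m).

Definition pprod p (j : nat) : G := (\prod_(i < m | (i < j)%N) p i)%g.

Lemma pprod0 p : pprod p 0 = 1%g.
Proof. by rewrite /pprod big_pred0. Qed.

Lemma pprodS p (j : 'I_m) : pprod p j.+1 = (pprod p j * p j)%g.
Proof.
(* Extending [p] by 1 to all integers turns the filtered product over ['I_m] into a product over
   ['I_i], from which the last factor can be split off. *)
pose F (i : nat) := if insub i is Some i' then p i' else 1%g.
have FE (i : 'I_m) : p i = F i by rewrite /F valK.
have E i : (i <= m)%N -> pprod p i = (\prod_(l < i) F l)%g.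
  move=> im; rewrite (big_ord_widen _ F im) /pprod.
  by apply: eq_bigr => l _; exact: FE.
by rewrite !E ?big_ord_recr -?FE //; exact: ltnW.
Qed.

Lemma pprod_full p : pprod p m = rprod p.
Proof. by apply: eq_bigl => i; rewrite ltn_ord. Qed.

Lemma elem_braid_lo k p : elem_braid k p (ord_lo k) =
  (p (ord_lo k) * p (ord_hi k) * (p (ord_lo k))^-1)%g.
Proof. by rewrite /elem_braid eqxx. Qed.

Lemma elem_braid_hi k p : elem_braid k p (ord_hi k) = p (ord_lo k).
Proof. by rewrite /elem_braid hi_neq_lo eqxx. Qed.

Lemma elem_braid_other k p i : i != ord_lo k -> i != ord_hi k ->
  elem_braid k p i = p i.
Proof. by rewrite /elem_braid => /negbTE -> /negbTE ->. Qed.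

(** Only the product that ends between the two exchanged entries changes, since (a b a^-1) a = a b.
    Passing over this pair goes back two positions, hence the strong induction. *)
Lemma pprod_elem_braid k p (j : nat) : (j <= m)%N -> j != k.+1 ->
  pprod (elem_braid k p) j = pprod p j.
Proof.
have [n] := ubnP j; elim: n j => // n IH [|j] jn jm jk.
  by rewrite !pprod0.
have S := pprodS _ (Ordinal jm); rewrite !{}S /=.
have [jk1|jk1] := eqVneq j k.+1.
  have -> : Ordinal jm = ord_hi k by apply: val_inj.
  have Slo := pprodS _ (ord_lo k); rewrite /= in Slo.
  rewrite elem_braid_hi jk1 !Slo IH; [|lia|have := ltn_ord k; lia|lia].
  by rewrite elem_braid_lo -!mulgA mulVg mulg1.
rewrite IH; [|lia|lia|lia]; congr (_ * _)%g.
by apply: elem_braid_other; rewrite -val_eqE /=; lia.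
Qed.

Lemma rprod_elem_braid k p : rprod (elem_braid k p) = rprod p.
Proof.
by rewrite -!pprod_full pprod_elem_braid // gtn_eqF // -ltn_predRL.
Qed.

Lemma rprod_word_act w p : rprod (word_act w p) = rprod p.
Proof.
elim: w => //= -[k b] w <-; rewrite /letter_act /=; case: b.
  by rewrite -[RHS](congr1 (@rprod m G) (elem_braid_invK k _)) rprod_elem_braid.
exact: rprod_elem_braid.
Qed.

Lemma word_actK w : cancel (@word_act m G w) (word_act (word_inv w)).
Proof.
move=> p; have := congr1 (@^~ p) (@word_act_eq m G _ _ (word_mulVl w)).
by rewrite /= /word_act foldr_cat.
Qed.

Variable C : set G.
Hypothesis C_conj : forall g q : G, C q -> C (g * q * g^-1)%g.

Lemma cpower_letter_act a p : cpower C p -> cpower C (letter_act a p).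
Proof.
move: a => [k b] Cp i; rewrite /letter_act /elem_braid /elem_braid_inv /=.
case: b; (case: ifP => _; last case: ifP => _); [exact: Cp| |exact: Cp| |exact: Cp..].
  by have := C_conj (p (ord_hi k))^-1%g (Cp (ord_lo k)); rewrite invgK.
exact: C_conj.
Qed.

Lemma cpower_word_act w p : cpower C p -> cpower C (word_act w p).
Proof. by elim: w => //= a w IH /IH; exact: cpower_letter_act. Qed.

End PartialProducts.

Section LambdaParam.
Context {n : nat} {G : groupType}.

(** From the middle outwards, each entry of the second half undoes its mirror image, so the partial
    products retrace their way back. The induction is on the distance n - i to the middle. *)
Lemma pprod_Lambda (C : set G) (p : power (2 * n)%N G) i : Lambda n C p ->
  (i <= n)%N -> pprod p (2 * n - i)%N = pprod p i.
Proof.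
move=> [_ pr] /subKn <-; elim: (n - i)%N (leq_subr i n) => [|j IH] jn.
  by rewrite subn0; congr pprod; lia.
have i2n : ((n - j.+1) < 2 * n)%N by lia.
pose k : 'I_(2 * n)%N := Ordinal i2n.
have kE : (n - j = k.+1)%N by rewrite /=; lia.
have rE : (2 * n - (n - j.+1) = (rev_ord k).+1)%N by rewrite /=; lia.
rewrite rE pprodS pr /=; last by lia.
rewrite (_ : (2 * n - (n - j.+1).+1 = 2 * n - (n - j))%N); last by lia.
by rewrite IH ?(ltnW jn) // kE pprodS mulgK.
Qed.

Lemma rprod_Lambda (C : set G) (p : power (2 * n)%N G) : Lambda n C p -> rprod p = 1%g.
Proof.
by move=> Lp; rewrite -pprod_full -[X in pprod _ X]subn0 (pprod_Lambda Lp) // pprod0.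
Qed.

Definition half_index (i : 'I_n) : 'I_(2 * n)%N := widen_ord (leq_pmull n (isT : 0 < 2)%N) i.

Definition first_half (p : power (2 * n)%N G) : power n G := fun i => p (half_index i).

(** The inverse of [first_half] on [Lambda]. The final value 1 is never reached: by
    [half_index_or_rev] each index is in the first half or mirrors one that is. *)
Definition fold_back (p : power n G) : power (2 * n)%N G := fun j =>
  if insub (val j) is Some i then p i
  else if insub (val (rev_ord j)) is Some i then (p i)^-1%g else 1%g.

Lemma fold_back_half_index p i : fold_back p (half_index i) = p i.
Proof. by rewrite /fold_back valK. Qed.

Lemma fold_back_rev p i : fold_back p (rev_ord (half_index i)) = (p i)^-1%g.
Proof.
rewrite /fold_back rev_ordK valK insubN //=.
by have := ltn_ord i; lia.
Qed.

Lemma half_indexP (j : 'I_(2 * n)%N) : (j < n)%N -> exists i, j = half_index i.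
Proof. by move=> jn; exists (Ordinal jn); apply: val_inj. Qed.

Lemma half_index_or_rev (j : 'I_(2 * n)%N) :
  exists i, j = half_index i \/ j = rev_ord (half_index i).
Proof.
have [/half_indexP[i ->]|nj] := ltnP j n; first by exists i; left.
have rn : (rev_ord j < n)%N by rewrite /=; have := ltn_ord j; lia.
have [i iE] := half_indexP rn; exists i; right.
by rewrite -iE rev_ordK.
Qed.

Lemma fold_backK : cancel fold_back first_half.
Proof. by move=> p; apply/funext => i; rewrite /first_half fold_back_half_index. Qed.

Variable C : set G.
Hypothesis C_inv : C = [set g : G | C (g^-1)%g].

Lemma fold_back_Lambda p : cpower C p -> Lambda n C (fold_back p).
Proof.
move=> Cp; split=> [j|j /half_indexP[i ->]].
  have [i [->|->]] := half_index_or_rev j; first by rewrite fold_back_half_index.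
  by rewrite fold_back_rev C_inv /= invgK.
by rewrite fold_back_rev fold_back_half_index.
Qed.

Lemma first_half_Lambda q : Lambda n C q -> cpower C (first_half q) /\ fold_back (first_half q) = q.
Proof.
move=> [Cq qr]; split=> [i|]; first exact: Cq.
apply/funext => j; have [i [->|->]] := half_index_or_rev j.
  by rewrite fold_back_half_index.
by rewrite fold_back_rev qr /= ?ltn_ord.
Qed.

End LambdaParam.

(** * The submanifolds *)

Section SmoothPower.
Context {R : realType} {d m : nat} {G : lieGroupType R d}.
Implicit Types (p : power m G) (w : braid_word m).

Lemma good_charts_lie_power : good_charts (power m G).
Proof. exact: good_charts_power (@good_charts_lie R d G). Qed.

Lemma smooth_at_proj (i : 'I_m) p : smooth_at (fun q : power m G => q i) p.
Proof. by have [] := smooth_tmap_proj (@good_charts_lie R d G) i p. Qed.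

Lemma smooth_at_prod (r : seq 'I_m) (P : pred 'I_m) p :
  smooth_at (fun q : power m G => (\prod_(i <- r | P i) q i)%g) p.
Proof.
have gP := good_charts_lie_power.
elim: r => [|i r IH].
  have -> : (fun q : power m G => (\prod_(i <- [::] | P i) q i)%g) = cst 1%g.
    by apply/funext => q; rewrite big_nil.
  exact: smooth_at_cst.
have -> : (fun q : power m G => (\prod_(j <- i :: r | P j) q j)%g) =
    fun q => ((if P i then q i else 1) * \prod_(j <- r | P j) q j)%g.
  by apply/funext => q; rewrite big_cons; case: ifP => //; rewrite mul1g.
apply: smooth_at_mulg => //; case: (P i); first exact: smooth_at_proj.
exact: smooth_at_cst.
Qed.

Lemma smooth_at_pprod (j : nat) p : smooth_at (fun q : power m G => pprod q j) p.
Proof. exact: smooth_at_prod. Qed.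

Lemma smooth_at_rprod p : smooth_at (fun q : power m G => rprod q) p.
Proof. exact: smooth_at_prod. Qed.

Lemma smooth_at_elem_braid k p : smooth_at (elem_braid k : power m G -> power m G) p.
Proof.
have gP := good_charts_lie_power; apply: smooth_at_power => i.
rewrite /elem_braid; case: (i == ord_lo k); last first.
  by case: (i == ord_hi k); exact: smooth_at_proj.
apply: smooth_at_mulg => //; last apply: smooth_at_invg => //.
  by apply: smooth_at_mulg => //; exact: smooth_at_proj.
exact: smooth_at_proj.
Qed.

Lemma smooth_at_elem_braid_inv k p :
  smooth_at (elem_braid_inv k : power m G -> power m G) p.
Proof.
have gP := good_charts_lie_power; apply: smooth_at_power => i.
rewrite /elem_braid_inv; case: (i == ord_lo k); first exact: smooth_at_proj.
case: (i == ord_hi k); last exact: smooth_at_proj.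
apply: smooth_at_mulg => //; last exact: smooth_at_proj.
apply: smooth_at_mulg => //; last exact: smooth_at_proj.
by apply: smooth_at_invg => //; exact: smooth_at_proj.
Qed.

Lemma smooth_at_word_act w p : smooth_at (@word_act m G w) p.
Proof.
have gP := good_charts_lie_power.
elim: w => [|[k b] w IH]; first by have [] := smooth_tmap_id gP p.
apply: (smooth_at_comp gP gP (finite_coords_mx _ _) IH).
by case: b; [exact: smooth_at_elem_braid_inv | exact: smooth_at_elem_braid].
Qed.

End SmoothPower.

Section Submanifolds.
Context {R : realType} {d n : nat} {G : lieGroupType R d}.

Lemma smooth_at_first_half p : smooth_at (@first_half n G) p.
Proof. by apply: smooth_at_power => i; exact: smooth_at_proj. Qed.

Lemma smooth_at_fold_back p : smooth_at (@fold_back n G) p.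
Proof.
apply: smooth_at_power => j; rewrite /fold_back.
case: insub => [i|]; first exact: smooth_at_proj.
case: insub => [i|]; last exact: smooth_at_cst.
by apply: smooth_at_invg; [exact: good_charts_lie_power | exact: smooth_at_proj].
Qed.

Variables (O : set 'rV[R]_d) (C U : set G).
Hypothesis O_domain : exp_domain (G := G) O.
Hypothesis C_class : conjugacy_class C.
Hypothesis C_square : forall p, C p -> centerg (p * p)%g.
Hypothesis C_inv : C = [set g : G | C (g^-1)%g].
Hypothesis U_open : open U.

(** [c] is the dimension of the (-1)-eigenspaces; it is chosen before the word, so the dimensions do
    not depend on the braid. *)
Lemma submanifolds : exists c, forall w : braid_word (2 * n)%N,
  submanifold (n * c)%N (word_act w @` Lambda n C) /\
  submanifold (2 * (n * c))%N (calM (2 * n)%N C U).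
Proof.
have [c cP] := class_local_chart C_class C_square O_domain.
have cpowerP m (p : power m G) : cpower C p ->
    exists (W : set 'rV[R]_(m * c)) D (f : 'rV[R]_(m * c) -> power m G) h,
      local_chart (cpower C) W D f h /\ D p.
  move=> Cp.
  have /choice[F FP] : forall i, exists F : set 'rV[R]_c * set G *
      ('rV[R]_c -> G) * (G -> 'rV[R]_c),
      local_chart C F.1.1.1 F.1.1.2 F.1.2 F.2 /\ F.1.1.2 (p i).
    move=> i; have [W [D [f [h Wfh]]]] := cP _ (Cp i).
    by exists (W, D, f, h).
  have lc := local_chart_power (@good_charts_lie R d G) p (fun i => (FP i).1).
  by do 4 eexists; split; [exact: lc | move=> i; exact: (FP i).2].
have gm m := @good_charts_lie_power R d m G.
exists c => w; split; last first.
  rewrite mulnA; apply: local_chart_submanifold => // p [Cp Up].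
  have [W [D [f [h [lc Dp]]]]] := cpowerP _ _ Cp.
  have Vo : open [set q : power (2 * n)%N G | U (rprod q)].
    by apply: open_comp U_open => q _; have [] := smooth_at_rprod q.
  by do 4 eexists; split; [exact: (local_chart_restrict Vo lc) | split].
apply: local_chart_submanifold => // _ [p Lp <-].
have [Chp hp] := first_half_Lambda Lp.
have [W [D [f [h [lc Dp]]]]] := cpowerP _ _ Chp.
do 4 eexists; split.
  (* C^n is identified with the image of [Lambda] under the word; the inverse undoes the word and
     forgets the second half, which makes sense on the whole power of the group. *)
  apply: (local_chart_map (i := word_act w \o fold_back)
    (r := first_half \o word_act (word_inv w)) (gm n) (gm _) _ _ _ _ _ lc).
  - exact: finite_coords_mx.
  - move=> q; apply: smooth_at_comp => //; first exact: finite_coords_mx.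
      exact: smooth_at_fold_back.
    exact: smooth_at_word_act.
  - move=> q; apply: smooth_at_comp => //; first exact: finite_coords_mx.
      exact: smooth_at_word_act.
    exact: smooth_at_first_half.
  - move=> q Cq; rewrite /= word_actK fold_backK; split=> //.
    by exists (fold_back q) => //; exact: fold_back_Lambda.
  - move=> _ [q Lq <-]; rewrite /= word_actK.
    by have [? ->] := first_half_Lambda Lq.
by rewrite /= word_actK.
Qed.

End Submanifolds.

(** * Sums of wedge products *)

Section Wedge.
Context {R : realType} {V : lmodType R}.
Variable ip : V -> V -> R.
Hypothesis ip_linear : forall c X Y Z, ip (c *: X + Y) Z = c * ip X Z + ip Y Z.
Hypothesis ip_sym : forall X Y, ip X Y = ip Y X.

(* the value on the pair of vectors [(u, v)] of the wedge product of two
   [V]-valued 1-forms whose values at [u] and [v] are the components of [x]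
   and [y] *)
Definition wedge (x y : V * V) : R := ip x.1 y.2 - ip y.1 x.2.

Lemma ipD X Y Z : ip (X + Y) Z = ip X Z + ip Y Z.
Proof. by rewrite -{1}[X]scale1r ip_linear mul1r. Qed.

Lemma ip0 Z : ip 0 Z = 0.
Proof. by apply: (addrI (ip 0 Z)); rewrite -ipD !addr0. Qed.

Lemma ipN X Z : ip (- X) Z = - ip X Z.
Proof. by apply/eqP; rewrite -addr_eq0 -ipD addNr ip0. Qed.

Lemma ipDr X Y Z : ip X (Y + Z) = ip X Y + ip X Z.
Proof. by rewrite ip_sym ipD !(ip_sym X). Qed.

Lemma ipNr X Z : ip X (- Z) = - ip X Z.
Proof. by rewrite ip_sym ipN ip_sym. Qed.

Lemma wedgeC x y : wedge x y = - wedge y x.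
Proof. by rewrite /wedge opprB. Qed.

Lemma wedgexx x : wedge x x = 0.
Proof. by rewrite /wedge subrr. Qed.

Lemma wedgeDl x y z : wedge (x + y) z = wedge x z + wedge y z.
Proof. by rewrite /wedge /= ipD ipDr; ring. Qed.

Lemma wedgeDr x y z : wedge x (y + z) = wedge x y + wedge x z.
Proof. by rewrite wedgeC wedgeDl opprD -!wedgeC. Qed.

Lemma wedgeNl x z : wedge (- x) z = - wedge x z.
Proof. by rewrite /wedge /= ipN ipNr; ring. Qed.

Lemma wedgeNr x z : wedge x (- z) = - wedge x z.
Proof. by rewrite wedgeC wedgeNl -wedgeC. Qed.

(** An isometric involution c is symmetric, so wedge(x, cx) = 0, and wedge(cx, cx) = 0 always. What
    is left is wedge(y, cx) = wedge(cy, x) = - wedge(y, x) = wedge(x, y). *)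
Lemma wedge_involution (c : V -> V) x1 x2 y1 y2 :
  (forall X Y, ip (c X) (c Y) = ip X Y) -> involutive c ->
  c y1 = - y1 -> c y2 = - y2 ->
  wedge (x1 + y1 - c x1, x2 + y2 - c x2) (c x1, c x2) =
  wedge (x1, x2) (y1, y2).
Proof.
move=> ipc cK cy1 cy2.
have ip_c X Y : ip (c X) Y = ip X (c Y) by rewrite -ipc cK.
have yc X Y : c Y = - Y -> ip Y (c X) = - ip X Y.
  by move=> cY; rewrite -ip_c cY ipN ip_sym.
rewrite /wedge /= !ipD !ipDr !ipN !ipNr (yc x2 y1 cy1) !ip_c cK.
by rewrite cy2 ipNr (ip_sym y1); ring.
Qed.

Definition psum m (e : 'I_m -> V * V) (j : nat) := \sum_(i < m | (i < j)%N) e i.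

(** The sum of the wedges of e_i and e_j over i < j, grouped by j as in the definition of
    [omega_c]. *)
Definition wedge_sum m (e : 'I_m -> V * V) := \sum_(j < m) wedge (psum e j) (e j).

Lemma psum0 m (e : 'I_m -> V * V) : psum e 0 = 0.
Proof. by rewrite /psum big_pred0. Qed.

Lemma psumS m (e : 'I_m -> V * V) (j : 'I_m) : psum e j.+1 = psum e j + e j.
Proof.
rewrite /psum (bigD1 j) //= addrC; congr (_ + _); apply: eq_bigl => i.
by rewrite -val_eqE /=; lia.
Qed.

(** With S the partial sum before the two adjacent entries a and b, their terms add up to S ^ (a +
    b) + a ^ b. All other terms involve a and b at most through a + b. *)
Lemma wedge_sum_exchange m (k : 'I_m.-1) (e e' : 'I_m -> V * V) :
  (forall i, i != ord_lo k -> i != ord_hi k -> e' i = e i) ->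
  e' (ord_lo k) + e' (ord_hi k) = e (ord_lo k) + e (ord_hi k) ->
  wedge (e' (ord_lo k)) (e' (ord_hi k)) = wedge (e (ord_lo k)) (e (ord_hi k)) ->
  wedge_sum e' = wedge_sum e.
Proof.
move=> ee eS eW.
have nhl : ord_hi k != ord_lo k by rewrite hi_neq_lo.
have pE (j : nat) : j != k.+1 -> psum e' j = psum e j.
  move=> jk; have [jle|kj] := leqP j k.
    by apply: eq_bigr => i ij; apply: ee; rewrite -val_eqE /=; lia.
  have S f : psum f j = f (ord_lo k) + f (ord_hi k) +
      \sum_(i < m | (i < j)%N && (i != ord_lo k) && (i != ord_hi k)) f i.
    rewrite /psum (bigD1 (ord_lo k)) //= (bigD1 (ord_hi k)) //= ?addrA //.
    by rewrite nhl andbT; lia.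
  rewrite !S eS; congr (_ + _); apply: eq_bigr => i /andP[/andP[_ il] ih].
  exact: ee.
have hiE f : psum f (ord_hi k) = psum f (ord_lo k) + f (ord_lo k).
  exact: (psumS f (ord_lo k)).
have E f : wedge_sum f = wedge (psum f (ord_lo k)) (f (ord_lo k) + f (ord_hi k)) +
    wedge (f (ord_lo k)) (f (ord_hi k)) +
    \sum_(i | (i != ord_lo k) && (i != ord_hi k)) wedge (psum f i) (f i).
  rewrite /wedge_sum (bigD1 (ord_lo k)) //= (bigD1 (ord_hi k)) //= hiE.
  by rewrite wedgeDl wedgeDr !addrA.
rewrite !E eS eW pE /=; last by lia.
congr (_ + _); apply: eq_bigr => i /andP[il ih]; rewrite ee //.
by rewrite pE //; apply: contraNN ih; rewrite -val_eqE.
Qed.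

(** The partial sums satisfy S_(2n-i) = S_i. Hence for j in the first half, the mirror image of the
    term S_j ^ e_j is S_(j+1) ^ (- e_j) = - S_j ^ e_j, and the sum added to its own reversal is
    0. *)
Lemma wedge_sum_antipalindrome n (e : 'I_(2 * n)%N -> V * V) :
  (forall i : 'I_(2 * n)%N, (i < n)%N -> e (rev_ord i) = - e i) ->
  wedge_sum e = 0.
Proof.
move=> er.
have pr i : (i <= n)%N -> psum e (2 * n - i)%N = psum e i.
  move=> /subKn <-; elim: (n - i)%N (leq_subr i n) => [|j IH] jn.
    by rewrite subn0; congr psum; lia.
  have i2n : ((n - j.+1) < 2 * n)%N by lia.
  pose k : 'I_(2 * n)%N := Ordinal i2n.
  have kE : (n - j = k.+1)%N by rewrite /=; lia.
  have rE : (2 * n - (n - j.+1) = (rev_ord k).+1)%N by rewrite /=; lia.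
  rewrite rE psumS er /=; last by lia.
  rewrite (_ : (2 * n - (n - j.+1).+1 = 2 * n - (n - j))%N); last by lia.
  by rewrite IH ?(ltnW jn) // kE psumS addrK.
pose t (j : 'I_(2 * n)%N) := wedge (psum e j) (e j).
have tr (j : 'I_(2 * n)%N) : (j < n)%N -> t j + t (rev_ord j) = 0.
  move=> jn; rewrite /t er // /= pr // psumS wedgeDl !wedgeNr wedgexx oppr0 addr0.
  by rewrite subrr.
have tr' j : t j + t (rev_ord j) = 0.
  have [/tr //|nj] := ltnP j n; rewrite addrC -{2}(rev_ordK j) tr //=.
  by have := ltn_ord j; lia.
have : wedge_sum e + wedge_sum e = 0.
  rewrite {2}/wedge_sum (reindex_inj rev_ord_inj) /= -big_split /=.
  by rewrite big1 // => j _; exact: tr'.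
by move/eqP; rewrite -mulr2n mulrn_eq0 /= => /eqP.
Qed.

End Wedge.

(** * The form omega_c *)

Section OmegaC.
Context {R : realType} {d m : nat} {G : lieGroupType R d}.
Variable ip : 'rV[R]_d -> 'rV[R]_d -> R.
Hypothesis ip_inner : Ad_invariant_inner_product (G := G) ip.
Implicit Types (p : power m G) (u v : 'M[R]_(m, d)).

Let gG := @good_charts_lie R d G.
Let gP := @good_charts_lie_power R d m G.

Let ip_linear c X Y Z : ip (c *: X + Y) Z = c * ip X Z + ip Y Z.
Proof. by have [-> _ _ _] := ip_inner. Qed.
Let ip_sym X Y : ip X Y = ip Y X.
Proof. by have [_ -> _ _] := ip_inner. Qed.
Let ip_Ad (a : G) X Y : ip (Ad a X) (Ad a Y) = ip X Y.
Proof. by have [_ _ _ ->] := ip_inner. Qed.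

Lemma wedge_Ad (a : G) X X' Y Y' :
  wedge ip (Ad a X, Ad a X') (Ad a Y, Ad a Y') = wedge ip (X, X') (Y, Y').
Proof. by rewrite /wedge /= !ip_Ad. Qed.

Definition xi p u (i : 'I_m) : 'rV[R]_d := mc_right (p i) (row i u).

Definition theta p u (i : 'I_m) : 'rV[R]_d := Ad (pprod p i) (xi p u i).

Definition theta2 p u v (i : 'I_m) := (theta p u i, theta p v i).

Lemma tmap_proj (i : 'I_m) p u : tmap (fun q : power m G => q i) p u = row i u.
Proof. by have [_ ->] := smooth_tmap_proj gG i p. Qed.

(** The cocycle rule of [mc_right_mulg], iterated: appending g_j adds its own velocity carried by Ad
    of the product before it, which is theta_j. *)
Lemma mc_right_pprod p u (j : nat) : (j <= m)%N ->
  mc_right (pprod p j) (tmap (fun q : power m G => pprod q j) p u) =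
  \sum_(i < m | (i < j)%N) theta p u i.
Proof.
elim: j => [_|j IH jm].
  have -> : (fun q : power m G => pprod q 0) = cst 1%g.
    by apply/funext => q; rewrite pprod0.
  by rewrite tmap_cst linear0 big_pred0.
pose jo := Ordinal jm.
have S q : pprod q j.+1 = (pprod q j * q jo)%g :> G := pprodS q jo.
have -> : (fun q : power m G => pprod q j.+1) = fun q => (pprod q j * q jo)%g.
  by apply/funext => q.
rewrite S (mc_right_mulg gP u (smooth_at_pprod j p) (smooth_at_proj jo p)).
rewrite IH ?(ltnW jm) // tmap_proj [RHS](bigD1 jo) //= [RHS]addrC.
congr (_ + _); apply: eq_bigl => i; rewrite -val_eqE /=; lia.
Qed.

Lemma sum_pair (I : finType) (P : pred I) (A B : nmodType) (f : I -> A) (g : I -> B) :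
  \sum_(i | P i) (f i, g i) = (\sum_(i | P i) f i, \sum_(i | P i) g i).
Proof. by rewrite [LHS]surjective_pairing (raddf_sum fst) (raddf_sum snd). Qed.

Lemma omega_c_wedge p u v :
  omega_c ip p u v = - (2^-1 * wedge_sum ip (theta2 p u v)).
Proof.
rewrite /omega_c mulr_sumr; congr (- _).
have tE (j : 'I_m) x : tmap (Emap j : power m G -> G * G) p x =
    (tmap (fun q : power m G => pprod q j) p x, row j x).
  rewrite -(tmap_proj j p x).
  exact: (tmap_pair x (smooth_at_pprod j p) (smooth_at_proj j p)).
have E (j : 'I_m) : pullback2 (Emap j) (Omega ip) p u v =
    2^-1 * wedge ip (psum (theta2 p u v) j) (theta2 p u v j).
  rewrite /pullback2 !tE /Omega /=; congr (_ * _).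
  have S x := mc_right_pprod p x (ltnW (ltn_ord j)).
  rewrite /psum sum_pair /wedge /= -/(pprod p j) !mc_leftE !S.
  rewrite -/(xi p u j) -/(xi p v j).
  (* The left form of the partial product P is Ad(P^-1) of its right form; invariance of [ip] moves
     Ad(P) to the other argument, where it makes theta_j out of xi_j. *)
  by congr (_ - _); rewrite -(ip_Ad (pprod p j)) AdVK.
(* [omega_c] omits the index 0 and [wedge_sum] does not; the extra term has an empty partial sum. *)
rewrite [RHS](bigID (fun j : 'I_m => (0 < j)%N)) /= [X in _ + X]big1 ?addr0.
  by apply: eq_bigr => j _; rewrite E.
move=> j; rewrite lt0n negbK => /eqP j0; rewrite j0 psum0.
by rewrite /wedge /= (ip0 ip_linear) ip_sym (ip0 ip_linear) subrr mulr0.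
Qed.

(** With x = xi_lo, y = Ad(a) xi_hi and c = a b a^-1, the braid replaces the pair (x, y) by (x + y -
    Ad(c) x, Ad(c) x), up to the common isometry Ad(Q). The sum is visibly the same, and
    [wedge_involution] handles the wedge. Tangency matters only at the upper entry, where it says
    Ad(c) y = - y. *)
Lemma omega_c_elem_braid (k : 'I_m.-1) p u v :
  (forall X, Ad (p (ord_hi k)) (Ad (p (ord_hi k)) X) = X) ->
  Ad (p (ord_hi k)) (xi p u (ord_hi k)) = - xi p u (ord_hi k) ->
  Ad (p (ord_hi k)) (xi p v (ord_hi k)) = - xi p v (ord_hi k) ->
  omega_c ip (elem_braid k p) (tmap (elem_braid k) p u) (tmap (elem_braid k) p v) =
  omega_c ip p u v.
Proof.
set a := p (ord_lo k); set b := p (ord_hi k).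
pose c := (a * b * a^-1)%g; pose q := elem_braid k p.
have tE (i : 'I_m) x : row i (tmap (elem_braid k : power m G -> power m G) p x) =
    tmap (fun y : power m G => elem_braid k y i) p x.
  exact: (row_tmap gP gG _ _ (smooth_at_elem_braid k p)).
have slo := smooth_at_proj (ord_lo k) p; have shi := smooth_at_proj (ord_hi k) p.
have xi_lo x : xi q (tmap (elem_braid k) p x) (ord_lo k) =
    xi p x (ord_lo k) + Ad a (xi p x (ord_hi k)) - Ad c (xi p x (ord_lo k)).
  rewrite /xi tE /q.
  have -> : (fun y : power m G => elem_braid k y (ord_lo k)) =
      fun y => (y (ord_lo k) * y (ord_hi k) * (y (ord_lo k))^-1)%g.
    by apply/funext => y; rewrite elem_braid_lo.
  have sab := smooth_at_mulg gP slo shi.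
  rewrite elem_braid_lo (mc_right_mulg gP x sab (smooth_at_invg gP slo)).
  rewrite (mc_right_mulg gP x slo shi) (mc_right_invg gP x slo) !tmap_proj.
  by rewrite linearN /= -AdM.
have xi_hi x : xi q (tmap (elem_braid k) p x) (ord_hi k) = xi p x (ord_lo k).
  rewrite /xi tE /q.
  have -> : (fun y : power m G => elem_braid k y (ord_hi k)) = fun y => y (ord_lo k).
    by apply/funext => y; rewrite elem_braid_hi.
  by rewrite elem_braid_hi (tmap_proj (ord_lo k) p x).

have xi_other x i : i != ord_lo k -> i != ord_hi k ->
    xi q (tmap (elem_braid k) p x) i = xi p x i.
  move=> il ih; rewrite /xi tE /q.
  have -> : (fun y : power m G => elem_braid k y i) = fun y => y i.
    by apply/funext => y; rewrite elem_braid_other.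
  by rewrite elem_braid_other // (tmap_proj i p x).
set Q := pprod p k.
have Qlo : pprod q (ord_lo k) = Q.
  by rewrite pprod_elem_braid //= ?(ltnW (ltn_ord (ord_lo k))) //; lia.
have Qhi : pprod q (ord_hi k) = (Q * c)%g.
  by rewrite -[LHS]/(pprod q (ord_lo k).+1) pprodS Qlo /q elem_braid_lo.
have Phi : pprod p (ord_hi k) = (Q * a)%g by exact: (pprodS p (ord_lo k)).
have theta_lo x : theta q (tmap (elem_braid k) p x) (ord_lo k) =
    Ad Q (xi p x (ord_lo k) + Ad a (xi p x (ord_hi k)) - Ad c (xi p x (ord_lo k))).
  by rewrite /theta Qlo xi_lo.
have theta_lo' x : theta p x (ord_lo k) = Ad Q (xi p x (ord_lo k)) by exact: erefl.
have theta_hi x : theta q (tmap (elem_braid k) p x) (ord_hi k) =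
    Ad Q (Ad c (xi p x (ord_lo k))).
  by rewrite /theta Qhi xi_hi AdM.
have theta_hi' x : theta p x (ord_hi k) = Ad Q (Ad a (xi p x (ord_hi k))).
  by rewrite /theta Phi AdM.
pose e := theta2 p u v.
pose e' := theta2 q (tmap (elem_braid k) p u) (tmap (elem_braid k) p v).
have reduce : wedge ip (e' (ord_lo k)) (e' (ord_hi k)) =
    wedge ip (e (ord_lo k)) (e (ord_hi k)) ->
    omega_c ip q (tmap (elem_braid k) p u) (tmap (elem_braid k) p v) =
    omega_c ip p u v.
  rewrite !omega_c_wedge -/e' -/e => we.
  suff -> : wedge_sum ip e' = wedge_sum ip e by [].
  apply: (wedge_sum_exchange ip_linear ip_sym (k := k)) we.
    move=> i il ih.
    have Pi : pprod q i = pprod p i.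
      apply: pprod_elem_braid; first exact: ltnW.
      by apply: contraNN ih; rewrite -val_eqE.
    by rewrite /e' /e /theta2 /theta Pi (xi_other u i il ih) (xi_other v i il ih).
  have AdD X Y : Ad Q X + Ad Q Y = Ad Q (X + Y) by rewrite linearD.
  have S x : theta q (tmap (elem_braid k) p x) (ord_lo k) +
      theta q (tmap (elem_braid k) p x) (ord_hi k) =
      theta p x (ord_lo k) + theta p x (ord_hi k).
    by rewrite theta_lo theta_hi theta_hi' theta_lo' AdD AdD subrK.
  rewrite /e' /e /theta2 -[LHS]/(_ + _, _ + _) -[RHS]/(_ + _, _ + _).
  by rewrite (S u) (S v).
move=> b2 ub vb; apply: reduce.
rewrite /e' /e /theta2 !theta_lo !theta_hi !theta_hi' !theta_lo' !wedge_Ad.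
(* Ad(a b a^-1) Ad(a) = Ad(a) Ad(b): the eigenvector equation at b is conjugated by a. *)
have cy x : Ad b (xi p x (ord_hi k)) = - xi p x (ord_hi k) ->
    Ad c (Ad a (xi p x (ord_hi k))) = - Ad a (xi p x (ord_hi k)).
  by move=> xb; rewrite /c !AdM AdK xb linearN.
apply: (wedge_involution ip_linear ip_sym) => [X Y|X||].
- exact: ip_Ad.
- by rewrite /c !AdM AdK b2 AdVK.
- exact: cy _ ub.
- exact: cy _ vb.
Qed.

End OmegaC.

(** * Isotropy *)

Section Velocities.
Context {R : realType}.

(* Unlike [tangent], this does not ask the parametrization to be an immersion,
   and is thus preserved by any smooth map. *)
Definition velocity (E : normedModType R) (M : chartedType E) (S : set M)
    (p : M) (v : E) :=
  exists k (f : 'rV[R]_k -> M) x u,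
    [/\ smooth_at f x, (\forall y \near x, S (f y)), f x = p & v = tmap f x u].

Lemma tangent_velocity (E : normedModType R) (M : chartedType E) (S : set M)
    (p : M) (v : E) : tangent S p v -> velocity S p v.
Proof.
move=> [k [W [f [x [u [[Wo fs _ _ fW] Wx fx ->]]]]]].
exists k, f, x, u; split=> //; first exact: fs.
have [S' _ fS] := fW _ Wo (fun _ => id).
apply: filterS (open_nbhs_nbhs (conj Wo Wx)) => y Wy.
by have [] : (S `&` S') (f y) by rewrite -fS; exists y.
Qed.

Lemma velocity_map (E F : normedModType R) (M : chartedType E)
    (N : chartedType F) (S : set M) (S' : set N) (h : M -> N) (p : M) (v : E) :
  good_charts M -> finite_coords E -> smooth_at h p ->
  (forall q, S q -> S' (h q)) ->
  velocity S p v -> velocity S' (h p) (tmap h p v).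
Proof.
move=> gM fE hp SS' [k [f [x [u [fx fS fxp ->]]]]].
have gr := @good_charts_mx R 1 k.
rewrite -fxp in hp *; exists k, (h \o f), x, u; split=> //.
- exact: smooth_at_comp.
- by apply: filterS fS => y /SS'.
- by rewrite (tmap_comp gr gM fx hp).
Qed.

Lemma sub_velocity (E : normedModType R) (M : chartedType E) (S S' : set M)
    (p : M) (v : E) : S `<=` S' -> velocity S p v -> velocity S' p v.
Proof.
move=> SS' [k [f [x [u [fx fS fxp vE]]]]]; exists k, f, x, u; split=> //.
by apply: filterS fS => y /SS'.
Qed.

Context {d : nat} {G : lieGroupType R d}.
Variable C : set G.
Hypothesis C_class : conjugacy_class C.
Hypothesis C_square : forall p, C p -> centerg (p * p)%g.

Let gG := @good_charts_lie R d G.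

Lemma xi_tmap m k (f : 'rV[R]_k -> power m G) x u i : smooth_at f x ->
  xi (f x) (tmap f x u) i = mc_right (f x i) (tmap (fun y => f y i) x u).
Proof.
move=> fx; rewrite /xi; congr mc_right.
exact: (row_tmap (@good_charts_mx R 1 k) gG u i fx).
Qed.

Lemma smooth_at_coord m k (f : 'rV[R]_k -> power m G) x i : smooth_at f x ->
  smooth_at (fun y => f y i) x.
Proof.
move=> fx; exact: (smooth_at_comp (@good_charts_mx R 1 k)
  (@good_charts_lie_power R d m G) (finite_coords_mx _ _) fx (smooth_at_proj i (f x))).
Qed.

(* differentiate [p i * p i = const] *)
Lemma velocity_class m (p : power m G) u i : velocity (cpower C) p u ->
  Ad (p i) (xi p u i) = - xi p u i.
Proof.
move=> [k [f [x [w [fx fC <- ->]]]]]; rewrite xi_tmap //.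
have gr := @good_charts_mx R 1 k; have fi := smooth_at_coord i fx.
have sff := smooth_at_mulg gr fi fi.
have ffE : {near x, (fun y => f y i * f y i)%g =1 cst (f x i * f x i)%g}.
  have Cfx := nbhs_singleton fC; apply: filterS fC => y Cfy.
  exact: (class_sq C_class C_square (Cfy i) (Cfx i)).
have t0 : tmap (fun y => f y i * f y i)%g x w = 0.
  rewrite -(tmap_near_eq gr ffE sff); exact: tmap_cst.
have := mc_right_mulg gr w fi fi; rewrite t0 linear0 => /esym/eqP.
by rewrite addrC addr_eq0 => /eqP.
Qed.

(** The derivative of the relation p_(rev i) = p_i^-1 along a family of points of [Lambda]. *)
Lemma velocity_Lambda n (p : power (2 * n)%N G) u (i : 'I_(2 * n)%N) :
  velocity (Lambda n C) p u -> (i < n)%N ->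
  xi p u (rev_ord i) = - Ad (p i)^-1%g (xi p u i).
Proof.
move=> [k [f [x [w [fx fL <- ->]]]]] ltin; rewrite !xi_tmap //.
have gr := @good_charts_mx R 1 k; have fi := smooth_at_coord i fx.
have fVE : {near x, (fun y => (f y i)^-1)%g =1 (fun y => f y (rev_ord i))}.
  by apply: filterS fL => y [_ /(_ i ltin)].
have fri : f x (rev_ord i) = (f x i)^-1%g by rewrite -(nbhs_singleton fVE).
have sV := smooth_at_invg gr fi.
rewrite fri (tmap_near_eq gr fVE sV); exact: mc_right_invg.
Qed.

Variable ip : 'rV[R]_d -> 'rV[R]_d -> R.
Hypothesis ip_inner : Ad_invariant_inner_product (G := G) ip.

Lemma omega_c_Lambda n (p : power (2 * n)%N G) u v : Lambda n C p ->
  velocity (Lambda n C) p u -> velocity (Lambda n C) p v ->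
  omega_c ip p u v = 0.
Proof.
move=> Lp Lu Lv; have [ipl ips _ _] := ip_inner.
have thetaN x (i : 'I_(2 * n)%N) : velocity (Lambda n C) p x -> (i < n)%N ->
    theta p x (rev_ord i) = - theta p x i.
  move=> Lx ltin; rewrite /theta (velocity_Lambda Lx ltin) /=.
  (* The product before the mirrored index is P_(2n-(i+1)) = P_(i+1) = P_i p_i, whose last factor
     cancels the p_i^-1 of [velocity_Lambda]. *)
  rewrite (pprod_Lambda Lp) // pprodS linearN /= -AdM.
  by rewrite mulgK.
rewrite (omega_c_wedge ip_inner).
rewrite (wedge_sum_antipalindrome ipl ips) ?mulr0 ?oppr0 // => i ltin.
by rewrite /theta2 (thetaN u) // (thetaN v).
Qed.

(** Induction on the word, using invariance under [elem_braid] only. At an inverse letter the point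
    and the vectors are pushed forward by [elem_braid]; at a positive one they are themselves such
    images, of what [elem_braid_inv] makes of them. Either way one lands in the image of [Lambda]
    under the shorter word. *)
Lemma omega_c_word_act n (w : braid_word (2 * n)%N) (p : power (2 * n)%N G) u v :
  let L := word_act w @` Lambda n C in
  L p -> velocity L p u -> velocity L p v -> omega_c ip p u v = 0.
Proof.
have gP := @good_charts_lie_power R d (2 * n)%N G.
have fP := @finite_coords_mx R (2 * n)%N d.
have LC w' : word_act w' @` Lambda n C `<=` cpower C.
  by move=> _ [q [Cq _] <-]; apply: cpower_word_act Cq; exact: class_conj.
elim: w p u v => [|[k b] w IH] p u v L; rewrite {}/L.
  have -> : @word_act (2 * n)%N G [::] @` Lambda n C = Lambda n C.
    exact: image_id.
  by move=> Lp Lu Lv; exact: omega_c_Lambda Lp Lu Lv.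
move=> Lp Lu Lv.
have inv (q : power (2 * n)%N G) x y : cpower C q -> velocity (cpower C) q x ->
    velocity (cpower C) q y ->
    omega_c ip (elem_braid k q) (tmap (elem_braid k) q x) (tmap (elem_braid k) q y) =
    omega_c ip q x y.
  move=> Cq Cx Cy; apply: (omega_c_elem_braid ip_inner).
  - by move=> X; exact: (Ad_class_invol C_square X (Cq _)).
  - exact: velocity_class.
  - exact: velocity_class.
case: b Lp Lu Lv => Lp Lu Lv.
  have back q : (word_act ((k, true) :: w) @` Lambda n C) q ->
      (word_act w @` Lambda n C) (elem_braid k q).
    by move=> [r Lr <-]; exists r => //=; rewrite /letter_act /= elem_braid_invK.
  have sb := smooth_at_elem_braid k p.
  have Sw := LC ((k, true) :: w).
  rewrite -inv; [|exact: Sw|exact: sub_velocity Sw Lu|exact: sub_velocity Sw Lv].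
  by apply: IH; [exact: back | exact: (velocity_map gP fP sb back Lu)
                | exact: (velocity_map gP fP sb back Lv)].
have back q : (word_act ((k, false) :: w) @` Lambda n C) q ->
    (word_act w @` Lambda n C) (elem_braid_inv k q).
  by move=> [r Lr <-]; exists r => //=; rewrite /letter_act /= elem_braidK.
have sb := smooth_at_elem_braid_inv k p.
have Lu' := velocity_map gP fP sb back Lu; have Lv' := velocity_map gP fP sb back Lv.
have id_tmap x : tmap (elem_braid k) (elem_braid_inv k p)
    (tmap (elem_braid_inv k) p x) = x.
  have := congr1 (@^~ x) (tmap_comp gP gP sb (smooth_at_elem_braid k _)).
  rewrite /= => <-; have -> : elem_braid k \o elem_braid_inv k = @id (power (2 * n)%N G).
    by apply/funext => q; exact: elem_braid_invK.
  by have [_ ->] := smooth_tmap_id gP p.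
rewrite -{1}(elem_braid_invK k p) -(id_tmap u) -(id_tmap v) inv.
- by apply: IH => //; exact: back.
- exact: (LC w _ (back _ Lp)).
- exact: sub_velocity (LC w) Lu'.
- exact: sub_velocity (LC w) Lv'.
Qed.

(** Ad(p) is a symmetric involution, so the two terms cancel for every X and Y, and in particular
    for those selected by [xget], whether or not u and v are tangent to C. *)
Lemma tauC_eq0 p u v : C p -> tauC ip p u v = 0.
Proof.
move=> Cp; have [_ ips _ ipA] := ip_inner; rewrite /tauC.
set X := xget _ _; set Y := xget _ _.
by rewrite -(ipA p X) (Ad_class_invol C_square) // (ips Y) subrr mulr0.
Qed.

(** The homotopy operator contracts with the position vector, here 0, so the integrand is 0 by
    linearity of the tangent maps alone. *)
Lemma beta0 v w : beta (G := G) ip 0 v w = 0.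
Proof.
rewrite /beta /homotopy3.
have [ipl ips _ _] := ip_inner.
have -> : (fun t : R => t ^+ 2 * pullback3 exp (lambda (G := G) ip) (t *: 0) 0 v w) = cst 0.
  apply/funext => t; rewrite /pullback3 /lambda.
  have b0 Z : bracket (G := G) 0 Z = 0 by exact: linear0.
  by rewrite !linear0 b0 (ip0 ipl) !mulr0.
by rewrite /Rintegral integral0.
Qed.

End Velocities.

Theorem corollary5p2 (R : realType) (d : nat) (G : lieGroupType R d)
  (ip : 'rV[R]_d -> 'rV[R]_d -> R) (O : set 'rV[R]_d)
  (n : nat) (C U : set G)
  (G_compact : compact [set: G])
  (ip_inner : Ad_invariant_inner_product (G := G) ip)
  (O_domain : exp_domain (G := G) O)
  (n_ge1 : (1 <= n)%N)
  (C_class : conjugacy_class C)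
  (C_square : forall p : G, C p -> centerg (p * p)%g)
  (C_inv : C = [set g : G | C (g^-1)%g])
  (U_open : open U)
  (U_one : U 1%g)
  (U_conj : forall g u : G, U u -> U (g * u * g^-1)%g)
  (U_exp : U `<=` exp @` O)
  (M_symplectic : symplectic (calM (2 * n)%N C U) (omegaC ip O)) :
  forall t : braid (2 * n)%N,
    lagrangian_submanifold (calM (2 * n)%N C U) (omegaC ip O)
      (braid_act t @` Lambda n C).
Proof.
(* [braid_act t] unfolds to the action of the word [repr t], so the results on words apply as they
   stand. *)
move=> t; pose w : braid_word (2 * n)%N := repr t.
have [c /(_ w) [subL subM]] :=
  submanifolds (n := n) O_domain C_class C_square C_inv U_open.
have LM : braid_act t @` Lambda n C `<=` calM (2 * n)%N C U.
  move=> _ [q Lq <-]; split; last by rewrite rprod_word_act (rprod_Lambda Lq).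
  by have [Cq _] := Lq; apply: cpower_word_act Cq; exact: class_conj.
split=> //; first by exists (n * c)%N.
move=> p Lp u v /tangent_velocity Lu /tangent_velocity Lv.
have [Cp _] := LM _ Lp; have [q Lq qp] := Lp.
have [_ _ O0 _ _] := O_domain.
(* The product of the entries is 1 = exp(0) with 0 in [O], and injectivity of [exp] on [O] makes 0
   the only preimage there. *)
have rp : rtilde O p = 0.
  rewrite /rtilde -qp rprod_word_act (rprod_Lambda Lq) -(exp0 (G := G)).
  rewrite pinvKV ?inE // => X Y; rewrite !inE => OX OY.
  exact: (exp_inj_domain O_domain).
rewrite /omegaC (omega_c_word_act C_class C_square ip_inner Lp Lu Lv).
rewrite /pullback2 rp (beta0 ip_inner) subrr add0r.
by rewrite big1 // => i _; exact: (tauC_eq0 C_square ip_inner).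
Qed.
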